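(* Let $p$ be a prime, $s\ge1$, and let $a$ be an integer such that $x^{p^s}-a$ is irreducible over $\mathbb{Q}$ and $|a|$ is $p^s$-th power free, written as $|a|=\prod_{j=1}^{p^s-1}a_j^{\,j}$ with $a_1,\dots,a_{p^s-1}$ squarefree positive integers that are pairwise coprime. Assume that $p$ does not divide $\gcd(a,v_p(a))$ (i.e. either $p\nmid a$, or $p\mid a$ and $p\nmid v_p(a)$). Let $\theta$ be a root of $x^{p^s}-a$ and $K=\mathbb{Q}(\theta)$. Let $r=v_p(a^{p-1}-1)-1$ and $d=\min\{r,s\}$. For $0\le m<p^s$, let $k_m$ be the largest integer with $0\le k_m\le d$ such that $m\ge p^s-p^{s-k_m}$, let $j_m$ be given by $m=p^s-p^{s-k_m}+j_m$, and let $C_m=\prod_{j=1}^{p^s-1}a_j^{\lfloor jm/p^s\rfloor}$. For $m\ge\varphi(p^s)$ (equivalently $k_m\ge1$), fix an integer $a'_m$ congruent modulo $p^{k_m+1}$ to $a^{(p-2)p^{s-k_m-1}}$ if $k_m<s$, and to $a^{p-2}$ if $k_m=s$; let $w_m\in\mathbb{Z}$ satisfy $w_mC_m(a'_m)^{p^{k_m}-1}\equiv1\pmod{p^{k_m}}$, and put $$\delta_m=w_mC_m\theta^{j_m}\sum_{i=0}^{p^{k_m}-2}\left(a'_m\theta^{p^{s-k_m}}\right)^i.$$ Then: (i) if $r=0$ or $r=-1$, then $\{1,\frac{\theta}{C_1},\frac{\theta^2}{C_2},\dots,\frac{\theta^{p^s-1}}{C_{p^s-1}}\}$ is an integral basis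 of $K$; (ii) if $r\ge1$, then $\{1,\frac{\theta}{C_1},\dots,\frac{\theta^{\varphi(p^s)-1}}{C_{\varphi(p^s)-1}}\}\cup\{\frac{\theta^m+\delta_m}{p^{k_m}C_m}\mid \varphi(p^s)\le m\le p^s-1\}$ is an integral basis of $K$.
   Context: $v_p(x)$ denotes the exponent of the highest power of $p$ dividing the nonzero integer $x$ (with $v_p(x)=0$ if $p\nmid x$); $\varphi$ is Euler's totient function; $\lfloor\lambda\rfloor$ is the greatest integer not exceeding $\lambda$. An integral basis of $K$ is a $\mathbb{Z}$-basis of the ring of algebraic integers of $K$. *)

(* Defs.v *)
From HB Require Import structures.
From mathcomp Require Import all_boot all_order all_algebra all_field.

Import Order.TTheory GRing.Theory Num.Theory.
Local Open Scope ring_scope.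

(* For p prime and x != 0, logn p `|x| is the exponent of p in x; it is 0 when
   p does not divide x. *)
Definition vp (p : nat) (x : int) : nat := logn p `|x|%N.

Definition power_free (n m : nat) : Prop :=
  forall q : nat, prime q -> ~~ (q ^ n %| m)%N.

Definition squarefree (m : nat) : Prop := power_free 2 m.

Definition algebraic_integer {K : fieldExtType rat} (x : K) : Prop :=
  integralOver (intr : int -> K) x.

(* b is a basis of the Z-module of algebraic integers of K. *)
Definition integral_basis {K : fieldExtType rat} {n : nat} (b : 'I_n -> K)
  : Prop :=
  [/\ forall i, algebraic_integer (b i),
      forall x : K, algebraic_integer x ->
        exists c : 'I_n -> int, x = \sum_(i < n) (c i)%:~R * b i
    & forall c : 'I_n -> int,
        \sum_(i < n) (c i)%:~R * b i = 0 -> forall i, c i = 0].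

(* An integer rather than a natural number: r = -1 when p %| a. *)
Definition r_ (p : nat) (a : int) : int := (vp p (a ^+ p.-1 - 1))%:Z - 1.

Definition d_ (p s : nat) (a : int) : int := Num.min (r_ p a) s%:Z.

(* The maximum may be taken over k <= s because d <= s.  If r = -1, no k is
   admissible and the value is the meaningless 0; see k_P for 0 <= d. *)
Definition k_ (p s : nat) (a : int) (m : nat) : nat :=
  (\max_(k < s.+1 | (k%:Z <= d_ p s a)%R && (p ^ s - p ^ (s - k) <= m)) k)%N.

Lemma k_P (p s : nat) (a : int) (m : nat) (d_ge0 : 0 <= d_ p s a) :
  [/\ (k_ p s a m)%:Z <= d_ p s a,
      (p ^ s - p ^ (s - k_ p s a m) <= m)%N
    & forall k : nat, k%:Z <= d_ p s a ->
        (p ^ s - p ^ (s - k) <= m)%N -> (k <= k_ p s a m)%N].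
Proof.
have max k : k%:Z <= d_ p s a ->
    (p ^ s - p ^ (s - k) <= m)%N -> (k <= k_ p s a m)%N.
  move=> kd km; have ks : (k < s.+1)%N.
    by rewrite ltnS -lez_nat (le_trans kd) // /d_ ge_min lexx orbT.
  by apply: (leq_bigmax_cond (Ordinal ks)); rewrite /= kd km.
split=> //; rewrite /k_.
  elim/big_ind: _ => //= [x y xd yd|i /andP[] //].
  by case: (leqP x y).
elim/big_ind: _ => /= [|x y xm ym|i /andP[] //].
  by rewrite subn0 subnn.
by case: (leqP x y).
Qed.

Definition j_ (p s : nat) (a : int) (m : nat) : nat :=
  (m - (p ^ s - p ^ (s - k_ p s a m)))%N.

Definition C_ (p s : nat) (aj : nat -> nat) (m : nat) : nat :=
  (\prod_(1 <= j < p ^ s) aj j ^ (j * m %/ p ^ s))%N.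

Definition delta (p s : nat) (a : int) (aj : nat -> nat) (a' w : nat -> int)
    (K : fieldExtType rat) (theta : K) (m : nat) : K :=
  (w m)%:~R * (C_ p s aj m)%:R * theta ^+ j_ p s a m *
  \sum_(0 <= i < (p ^ k_ p s a m).-1)
     ((a' m)%:~R * theta ^+ (p ^ (s - k_ p s a m))) ^+ i.

(* Main.v *)
Require Import Defs.
From HB Require Import structures.
From mathcomp Require Import all_boot all_order all_algebra all_field.
From mathcomp Require Import boolp zify ring.

Import Order.TTheory GRing.Theory Num.Theory.
Local Open Scope ring_scope.

(* Write n = p^s. The candidate basis consists of polynomials in theta of degrees
   0, ..., n - 1 with leading coefficients 1 / (p^(k_m) C_m), so once its members
   are known to be integral it suffices to bound denominators: if f in Q[X] has
   degree m < n and f(theta) is integral then p^(k_m) C_m lc(f) is an integer.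
   This is checked one prime q at a time, evaluating f at all the roots z of
   X^n - a in algC.
   - If q <> p, averaging f(zeta z) against the powers of an n-th root of unity
     zeta shows that n f_m z^m is q-integral; take n-th powers.
   - If q = p divides a, then n is prime to v_p(a), some monomial
     pi = z^i / p^j satisfies pi^n = p * unit, and the powers of pi are
     independent modulo p in the Eisenstein manner.
   - If q = p does not divide a and p^2 does not divide a^p - a, then z - a is
     an Eisenstein element.
   - Otherwise a is close to a p-th power b^p, except when p = 2 and a = 5 mod 8,
     where one works over the unramified ring Z_2[(1 + sqrt a) / 2]. By
     continuity f is integral at the roots of X^n - b^p. Divide f by the factor
     Psi = (X^n - b^p) / (X^(n/p) - b): the remainder is integral because a shift
     makes Psi Eisenstein, and since Psi = p b^(p-1) at the roots of
     X^(n/p) - b, p times the quotient is integral there; induct on s. *)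

(** * [q]-integral algebraic numbers *)

(** The integral closure in [algC] of Z localized at q. All primes above q are treated at once, so
    no completion or extension of a valuation has to be chosen. *)
Definition pint (q : nat) : {pred algC} :=
  fun x => `[< exists2 N : nat, coprime N q & N%:R * x \in Aint >].

Lemma pintP q x :
  reflect (exists2 N : nat, coprime N q & N%:R * x \in Aint) (x \in pint q).
Proof. exact: asboolP. Qed.

Lemma Aint_pint q x : x \in Aint -> x \in pint q.
Proof. by move=> xA; apply/pintP; exists 1%N; rewrite ?coprime1n // mul1r. Qed.

Lemma pint_subring q : subring_closed (pint q).
Proof.
split=> [|x y /pintP[N Nq xA] /pintP[M Mq yA]|x y /pintP[N Nq xA] /pintP[M Mq yA]].
- exact/Aint_pint/Aint1.
- apply/pintP; exists (N * M)%N; first by rewrite coprimeMl Nq.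
  rewrite natrM mulrBr -mulrA mulrCA mulrAC -mulrA [y * _]mulrC.
  by rewrite rpredB // rpredM // Aint_Cnat // natr_nat.
- apply/pintP; exists (N * M)%N; first by rewrite coprimeMl Nq.
  by rewrite natrM mulrACA rpredM.
Qed.

HB.instance Definition _ q :=
  GRing.isSubringClosed.Build _ (pint q) (pint_subring q).

Lemma pint_nat_cancel q (N : nat) x :
  coprime N q -> N%:R * x \in pint q -> x \in pint q.
Proof.
move=> Nq /pintP[M Mq xA]; apply/pintP; exists (M * N)%N.
  by rewrite coprimeMl Mq.
by rewrite natrM -mulrA.
Qed.

Lemma pint_int_cancel q (u : int) x :
  coprime `|u| q -> u%:~R * x \in pint q -> x \in pint q.
Proof.
move=> uq; rewrite {1}[u]intEsign rmorphM rmorphXn rmorphN1 /= -mulrA.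
by rewrite rpredMsign; apply: pint_nat_cancel.
Qed.

Lemma pint_ratP q (x : rat) :
  reflect (exists2 N : nat, coprime N q & N%:R * x \in Num.int)
          (ratr x \in pint q).
Proof.
apply: (iffP (pintP _ _)) => -[N Nq xA]; exists N => //.
  have: ratr (N%:R * x) \in Aint by rewrite rmorphM /= ratr_nat.
  move=> /(Cint_rat_Aint (Crat_rat _)) /intrP[m mE]; apply/intrP; exists m.
  by apply: (fmorph_inj (ratr : {rmorphism rat -> algC})); rewrite /= mE ratr_int.
case/intrP: xA => m mE; rewrite -(ratr_nat algC) -rmorphM /= mE ratr_int.
exact: Aint_int.
Qed.

Lemma prime_coprimeC p N : prime p -> coprime N p = ~~ (p %| N)%N.
Proof. by move=> p_pr; rewrite coprime_sym prime_coprime. Qed.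

Lemma pint_rat_denq q (x : rat) :
  ratr x \in pint q -> coprime `|denq x| q.
Proof.
case/pint_ratP=> N Nq /intrP[m mE]; apply: coprime_dvdl Nq.
have: N%:Z * numq x = m * denq x.
  apply: (@intr_inj rat); rewrite !rmorphM /= -mE -mulrA -numqE.
  by [].
move/(congr1 absz); rewrite !abszM /= => eN.
have cop: coprime `|denq x| `|numq x| by rewrite coprime_sym coprime_num_den.
by rewrite -(Gauss_dvdl _ cop) eN dvdn_mull.
Qed.

Lemma pint_rat_int (x : rat) :
  (forall q, prime q -> ratr x \in pint q) -> x \in Num.int.
Proof.
move=> xP; have /eqP den1 : `|denq x|%N == 1%N.
  case: (leqP `|denq x| 1) => [|d_gt1].
    by have := denq_gt0 x; lia.
  have q_pr := pdiv_prime d_gt1.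
  have := pint_rat_denq _ _ (xP _ q_pr).
  by rewrite coprime_sym prime_coprime // pdiv_dvd.
by rewrite Qint_def; apply/eqP; have := denq_gt0 x; lia.
Qed.

Lemma pint_expn_cancel q (x : algC) n : (0 < n)%N -> x ^+ n \in pint q -> x \in pint q.
Proof.
move=> n_gt0 /pintP[N Nq xnA]; apply/pintP; exists N => //.
have: (N%:R * x) ^+ n \in Aint.
  rewrite exprMn -(prednK n_gt0) exprSr -mulrA prednK //.
  by rewrite rpredM // rpredX // Aint_Cnat // natr_nat.
set y := _ * x => ynA.
apply: (root_monic_Aint (p := minCpoly (y ^+ n) \Po 'X^n)).
- by rewrite root_comp hornerXn root_minCpoly.
- rewrite monicE lead_coef_comp ?size_polyXn ?ltnS // lead_coefXn expr1n.
  by rewrite mulr1 -monicE minCpoly_monic.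
- by rewrite polyOver_comp // polyOverXn.
Qed.

Lemma Aint_integralP x : x \in Aint <-> integralOver (intr : int -> algC) x.
Proof.
split=> [xA | [r r_mon rx]]; last first.
  apply: root_monic_Aint rx _ _; first exact: monic_map.
  by apply/polyOverP=> i; rewrite coef_map /= intr_int.
have /floorpP[r rE] : minCpoly x \is a polyOver Num.int by exact: xA.
exists r; last by rewrite -rE root_minCpoly.
have := minCpoly_monic x; rewrite rE !monicE lead_coef_map_inj //.
  by rewrite -[1](mulr1z) => /eqP/intr_inj ->.
exact: intr_inj.
Qed.

Lemma Aint_root_monic (h : {poly algC}) u :
  h \is monic -> h \is a polyOver Aint -> root h u -> u \in Aint.
Proof.
move=> h_mon /allP hA hu; apply/Aint_integralP.
by apply: (integral_root_monic h_mon hu) => c /hA; apply: (Aint_integralP _).1.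
Qed.

Lemma pint_common_denominator q (l : seq algC) :
    {subset l <= pint q} ->
  exists2 N, coprime N q & {in l, forall x, N%:R * x \in Aint}.
Proof.
elim: l => [|x l IHl] lP; first by exists 1%N; rewrite ?coprime1n.
have [|N Nq NP] := IHl; first by move=> y yl; rewrite lP // inE yl orbT.
have /pintP[M Mq xA] := lP x (mem_head _ _).
exists (M * N)%N; first by rewrite coprimeMl Mq.
move=> y; rewrite inE natrM => /predU1P[->|/NP yA].
  by rewrite mulrAC rpredM // Aint_Cnat // natr_nat.
by rewrite -mulrA rpredM // Aint_Cnat // natr_nat.
Qed.

(** Rescale the root: if N is a common denominator of the coefficients and d the degree, then N u is
    a root of the monic polynomial with coefficients h_i N^(d-i), which are algebraic integers. *)
Lemma pint_root_monic q (h : {poly algC}) u :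
  h \is monic -> h \is a polyOver (pint q) -> root h u -> u \in pint q.
Proof.
move=> h_mon /allP hP /rootP hu.
have [N Nq NP] := pint_common_denominator _ _ hP.
apply/pintP; exists N => //.
have [d sz_h] : exists d, size h = d.+1.
  by exists (size h).-1; rewrite prednK // size_poly_gt0 monic_neq0.
have hd : h`_d = 1 by move/monicP: h_mon; rewrite lead_coefE sz_h.
pose g := \poly_(i < d.+1) (h`_i * N%:R ^+ (d - i)).
have gd : g`_d = 1 by rewrite coef_poly ltnSn hd subnn mulr1.
have sz_g : size g = d.+1.
  by rewrite size_poly_eq //= hd subnn mulr1 oner_eq0.
apply: (@Aint_root_monic g).
- by rewrite monicE lead_coefE sz_g gd.
- apply/polyOverP=> i; rewrite coef_poly; case: ltnP => // id.
  have [->|ltid] : i = d \/ (i < d)%N by lia.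
    by rewrite hd subnn mulr1 Aint1.
  have hA : h`_i * N%:R \in Aint by rewrite mulrC NP // mem_nth // sz_h.
  rewrite -(subnSK ltid) exprS mulrA; apply: rpredM => //.
  by apply: rpredX; rewrite Aint_Cnat // natr_nat.
- apply/rootP; rewrite horner_poly.
  rewrite (eq_bigr (fun i : 'I_d.+1 => N%:R ^+ d * (h`_i * u ^+ i))).
    by rewrite -big_distrr /=; move: hu; rewrite horner_coef sz_h => ->; rewrite mulr0.
  move=> i _; have id : (i <= d)%N by rewrite -ltnS.
  have -> : N%:R ^+ d = N%:R ^+ (d - i) * N%:R ^+ i :> algC.
    by rewrite -exprD subnK.
  by rewrite exprMn; ring.
Qed.

(** * Eisenstein elements *)

Lemma subrXX_in (R : comNzRingType) (S : subringClosed R) (x y : R) m :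
  x \in S -> y \in S ->
  exists2 q, q \in S & x ^+ m - y ^+ m = (x - y) * q.
Proof.
move=> xS yS; rewrite subrXX; eexists; last by [].
by rewrite rpred_sum // => i _; rewrite rpredM ?rpredX.
Qed.

(** The inner binomial coefficients are divisible by p. The linear term is kept apart because the
    Newton step and the cyclotomic equation rest on it, and d^p because it carries no factor p. *)
Lemma exprD_prime (R : comNzRingType) (S : subringClosed R) (b d : R) p :
  prime p -> b \in S -> d \in S ->
  exists2 T, T \in S &
    (b + d) ^+ p = b ^+ p + p%:R * b ^+ p.-1 * d + p%:R * d ^+ 2 * T + d ^+ p.
Proof.
case: p => [|[|p']] // p_pr bS dS; set p := p'.+2 in p_pr *.
exists (\sum_(i < p') b ^+ (p - i.+2) * d ^+ i * ('C(p, i.+2) %/ p)%:R).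
  by rewrite rpred_sum // => i _; rewrite !rpredM ?rpredX ?rpred_nat.
rewrite exprDn big_ord_recl big_ord_recl big_ord_recr /=.
rewrite big_distrr /= -!addrA; congr (_ + (_ + (_ + _))).
- by rewrite subn0 bin0 mulr1n expr0 mulr1.
- by rewrite /bump /= add1n bin1 subn1 expr1 -mulr_natl mulrA.
- apply: eq_bigr => i _; rewrite /bump /= !add1n.
  have /divnK {1}<- : (p %| 'C(p, i.+2))%N.
    by rewrite prime_dvd_bin //=; have := ltn_ord i; rewrite /p; lia.
  by rewrite -mulr_natl natrM !exprS; ring.
- by rewrite /bump /= !add1n subnn binn mulr1n expr0 mul1r.
Qed.

(** The error keeps a factor x besides p: with x = z - b it then fits the term [pi * w] of an
    Eisenstein relation. *)
Lemma exprD_prime_pow (R : comNzRingType) (S : subringClosed R) (x y : R) p s :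
  prime p -> x \in S -> y \in S ->
  exists2 T, T \in S &
    (x + y) ^+ (p ^ s) = x ^+ (p ^ s) + y ^+ (p ^ s) + p%:R * x * T.
Proof.
move=> p_pr xS yS; elim: s => [|s [T TS IHs]].
  by exists 0; rewrite ?rpred0 // !expr1 mulr0 addr0.
have p_gt0 := prime_gt0 p_pr.
have [c cE] : exists c, (p ^ s = c.+1)%N.
  by exists (p ^ s).-1; rewrite prednK // expn_gt0 p_gt0.
pose h := x ^+ c + p%:R * T.
have hS : h \in S by rewrite rpredD ?rpredX // rpredM ?rpred_nat.
have [T1 T1S E1] := exprD_prime R S (y ^+ (p ^ s)) (x * h) p p_pr
  (rpredX _ yS) (rpredM xS hS).
have [T2 T2S E2] := exprD_prime R S (x ^+ (p ^ s)) (p%:R * x * T) p p_pr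
  (rpredX _ xS) (rpredM (rpredM (rpred_nat _ _) xS) TS).
have hE : x * h = x ^+ (p ^ s) + p%:R * x * T by rewrite /h cE exprS; ring.
exists (y ^+ (p ^ s) ^+ p.-1 * h + x * h ^+ 2 * T1
    + (p%:R * x ^+ (p ^ s) ^+ p.-1 * T + p%:R ^+ 2 * x * T ^+ 2 * T2
    + p%:R ^+ p.-1 * x ^+ p.-1 * T ^+ p)).
  by rewrite !(rpredD, rpredM, rpredX, rpred_nat).
rewrite expnSr !exprM IHs [_ + _ ^+ (p ^ s)]addrC -addrA -hE E1 {3}hE E2.
have -> : (p%:R * x * T) ^+ p = p%:R * x * (p%:R ^+ p.-1 * x ^+ p.-1 * T ^+ p).
  have eS (z : R) : z ^+ p = z * z ^+ p.-1.
    by rewrite -exprS prednK // prime_gt0.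
  by rewrite [LHS]eS [T ^+ p]eS !exprMn; ring.
by ring.
Qed.

(* The smallest [i] violating [P] is isolated by multiplying by
   [pi ^+ (e.-1 - i) / p]; the [e]-th power of [c i * pi ^+ e.-1 / p] then has a
   single [p] left in its denominator. *)
Lemma eisenstein_coefs p e (pi u w t : algC) (c : nat -> algC)
    (P : nat -> Prop) :
  (0 < p)%N -> (0 < e)%N ->
  pi \in pint p -> u \in pint p -> w \in pint p -> t \in pint p ->
  (forall i, (i < e)%N -> c i \in pint p) ->
  pi ^+ e = p%:R * (u + pi * w + p%:R * t) ->
  (forall i, (i < e)%N -> P i -> c i / p%:R \in pint p) ->
  (forall i, (i < e)%N -> c i ^+ e * u ^+ (e * e.-1) / p%:R \in pint p -> P i) ->
  (\sum_(i < e) c i * pi ^+ i) / p%:R \in pint p ->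
  forall i, (i < e)%N -> P i.
Proof.
move=> p_gt0 e_gt0 piS uS wS tS cS; set v := u + _ + _ => piE Pc cP sumS.
have pn0 : p%:R != 0 :> algC by rewrite pnatr_eq0 -lt0n.
have vS : v \in pint p by rewrite !(rpredD, rpredM, rpred_nat).
elim/ltn_ind=> i IHi ie; apply: cP => //.
have topS : c i * pi ^+ e.-1 / p%:R \in pint p.
  have := rpredM sumS (rpredX (e.-1 - i) piS).
  rewrite mulrAC big_distrl /= big_distrl /= (bigD1 (Ordinal ie)) //=.
  rewrite -(mulrA (c i) (pi ^+ i)) -exprD subnKC; last by lia.
  rewrite rpredDr //; apply: rpred_sum => j; rewrite -val_eqE /= => ji.
  rewrite -(mulrA (c j) (pi ^+ j)) -exprD.
  have [lt_ji|le_ij] := ltnP j i.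
    by rewrite mulrAC rpredM ?rpredX // Pc //; apply: IHi.
  have -> : (j + (e.-1 - i) = e + (j - i.+1))%N by lia.
  rewrite exprD piE.
  have -> : c j * (p%:R * v * pi ^+ (j - i.+1)) / p%:R
            = c j * (v * pi ^+ (j - i.+1)) by field.
  by rewrite !rpredM ?rpredX ?cS.
(* The e-th power of the number in [topS] is c_i^e v^(e-1) / p. Since p divides pi^e, factoring u^e
   - (- pi w)^e gives u^e = v T + p q, so after multiplication by T^(e-1) the power of v becomes
   u^(e(e-1)) modulo p. *)
have [T TS TE] : exists2 T, T \in pint p &
    u ^+ e - (- (pi * w)) ^+ e = (v - p%:R * t) * T.
  have mS : - (pi * w) \in pint p by rewrite rpredN rpredM.
  have [T TS ->] := subrXX_in _ _ _ _ e uS mS; exists T => //.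
  by rewrite /v; ring.
pose q := - t * T + (- w) ^+ e * v.
have qS : q \in pint p by rewrite rpredD // rpredM ?rpredX ?rpredN.
have qE : u ^+ e = v * T + p%:R * q.
  rewrite -[LHS](subrK ((- (pi * w)) ^+ e)) TE -(mulrN pi) exprMn piE /q; ring.
have [q' q'S q'E] := subrXX_in _ _ _ _ e.-1 (rpredX e uS) (rpredM vS TS).
have -> : c i ^+ e * u ^+ (e * e.-1) / p%:R
   = (c i * pi ^+ e.-1 / p%:R) ^+ e * T ^+ e.-1 + c i ^+ e * (q * q').
  rewrite exprM -[u ^+ e ^+ _](subrK ((v * T) ^+ e.-1)) q'E qE.
  rewrite !exprMn exprVn -exprM mulnC exprM piE exprMn.
  have -> : p%:R ^+ e = p%:R * p%:R ^+ e.-1 :> algC by rewrite -exprS prednK.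
  have pen0 : p%:R ^+ e.-1 != 0 :> algC by rewrite expf_neq0.
  by field; rewrite pn0 pen0.
by rewrite rpredD // !rpredM ?rpredX ?cS.
Qed.

(** * Descent of p-integrality to rational coefficients *)

Notation ratr_poly := (map_poly (ratr : rat -> algC)).

Lemma horner_ratr (g : {poly rat}) e (z : algC) :
  (size g <= e)%N -> (ratr_poly g).[z] = \sum_(i < e) ratr g`_i * z ^+ i.
Proof.
move=> sz_g; rewrite (@horner_coef_wide _ e) ?size_map_poly //.
by apply: eq_bigr => i _; rewrite coef_map.
Qed.

Lemma pint_bounded_denominator p (g : {poly rat}) : prime p ->
  exists M, forall i, p%:R ^+ M * ratr g`_i \in pint p.
Proof.
move=> p_pr; have [r [a a_neq0 gE]] := rat_poly_scale g.
have a_gt0 : (0 < `|a|)%N by rewrite absz_gt0.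
have [b pb aE] := pfactor_coprime p_pr a_gt0.
exists (logn p `|a|) => i; apply: (@pint_nat_cancel _ b).
  by rewrite coprime_sym.
suff -> : b%:R * (p%:R ^+ logn p `|a| * ratr g`_i)
          = ((-1) ^+ (a < 0)%R * r`_i)%:~R :> algC.
  exact/Aint_pint/Aint_int.
have aC : a%:~R != 0 :> algC by rewrite intr_eq0.
rewrite gE coefZ coef_map /= rmorphM fmorphV /= !ratr_int /=.
rewrite mulrA -natrX -natrM -aE -[_%:R]/((`|a|%N)%:~R) abszE.
rewrite normrEsign !rmorphM rmorphXn rmorphN1 /=.
by field.
Qed.

(** Rationality is what counts: p is prime in Z, whereas among algebraic numbers ramification allows
    p to divide x^e without dividing x. *)
Lemma pint_prime_dvdX p e (x : rat) : prime p ->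
  ratr x \in pint p -> ratr x ^+ e / p%:R \in pint p -> ratr x / p%:R \in pint p.
Proof.
move=> p_pr /pint_ratP[N Np /intrP[m mE]] xep.
have pn0 : p%:R != 0 :> rat by rewrite pnatr_eq0 -lt0n prime_gt0.
have /pint_ratP[N' N'p /intrP[l lE]] : ratr (x ^+ e / p%:R) \in pint p.
  by rewrite fmorph_div rmorphXn /= ratr_nat.
have /(congr1 absz) : N'%:Z * m ^+ e = N%:Z ^+ e * l * p%:Z.
  apply: (@intr_inj rat); rewrite !rmorphM !rmorphXn /= -mE -lE exprMn.
  by rewrite -[N'%:~R]/(N'%:R) -[N%:~R]/(N%:R) -[p%:~R]/(p%:R); field.
rewrite !abszM abszX !absz_nat => eNm.
have /dvdnP[m' m'E] : (p %| `|m|)%N.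
  have : (p %| N' * `|m| ^ e)%N by rewrite eNm dvdn_mull.
  rewrite Euclid_dvdM // -[(p %| N')%N]negbK -prime_coprimeC // N'p /=.
  by rewrite Euclid_dvdX // => /andP[].
rewrite -(ratr_nat algC) -fmorph_div /=; apply/pint_ratP; exists N => //.
by rewrite mulrA mE [m]intEsign m'E PoszM mulrA rmorphM /= mulfK.
Qed.

(** Descent on an M such that p^M clears the denominators at p: [eisenstein_coefs], applied to
    p^(M+1) g with [P] stating that p^M already suffices, removes one factor p at a time. *)
Lemma eisenstein_rat p e (pi w t : algC) (u : int) (g : {poly rat}) :
  prime p -> (0 < e)%N ->
  pi \in pint p -> w \in pint p -> t \in pint p -> coprime `|u| p ->
  pi ^+ e = p%:R * (u%:~R + pi * w + p%:R * t) ->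
  (size g <= e)%N -> (ratr_poly g).[pi] \in pint p ->
  forall i, ratr g`_i \in pint p.
Proof.
move=> p_pr e_gt0 piS wS tS up piE sz_g gS.
have p_gt0 := prime_gt0 p_pr.
have pn0 : p%:R != 0 :> algC by rewrite pnatr_eq0 -lt0n.
have [M] := pint_bounded_denominator _ g p_pr.
elim: M => [|M IHM] MP; first by move=> i; have := MP i; rewrite expr0 mul1r.
apply: IHM => i; have [ie|ei] := ltnP i e; last first.
  by rewrite nth_default ?(leq_trans sz_g) // rmorph0 mulr0 rpred0.
pose c i := p%:R ^+ M.+1 * ratr g`_i : algC.
have cE j : c j / p%:R = p%:R ^+ M * ratr g`_j by rewrite /c exprS; field.
move: i ie; apply: (@eisenstein_coefs p e pi u%:~R w t c) => //.
- exact/Aint_pint/Aint_int.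
- by move=> j _ ; rewrite /c.
- by move=> j _; rewrite cE.
- move=> j _; rewrite -rmorphXn /= -mulrA mulrCA => cS.
  have {cS} := pint_int_cancel _ _ _ _ cS; rewrite -cE.
  have -> : c j = ratr (p%:R ^+ M.+1 * g`_j).
    by rewrite rmorphM rmorphXn /= ratr_nat.
  move=> cS; apply: (pint_prime_dvdX _ e) => //; last first.
    by apply: cS; rewrite abszX coprimeXl.
  by rewrite rmorphM rmorphXn /= ratr_nat MP.
- rewrite big_distrl /=.
  rewrite (eq_bigr (fun i : 'I_e => p%:R ^+ M * (ratr g`_i * pi ^+ i))).
    rewrite -big_distrr rpredM ?rpredX ?rpred_nat //=.
    by rewrite -horner_ratr.
  by move=> j _; rewrite mulrAC cE mulrA.
Qed.

(** * Fermat congruences and shifted Eisenstein elements *)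

Lemma PoszX (n k : nat) : (n ^ k)%N%:Z = n%:Z ^+ k.
Proof. by rewrite -[LHS]natz natrX natz. Qed.

Lemma dvdz_fermat p (a : int) : prime p -> (p%:Z %| a ^+ p - a)%Z.
Proof.
move=> p_pr; rewrite -eqz_mod_dvd -modzXm.
have p_neq0 : p%:Z != 0 by have := prime_gt0 p_pr; lia.
have [r rE] : exists r : nat, (a %% p)%Z = r.
  by exists `|(a %% p)%Z|%N; have := modz_ge0 a p_neq0; lia.
rewrite -[X in _ == X]modz_mod rE -PoszX !modz_nat; apply/eqP; congr Posz.
exact: fermat_little.
Qed.

(** Expand (y + c p^j)^p: every term after y^p gains a factor p, the last one because p j >= j + 1
    for positive j. *)
Lemma dvdz_subXp p j (x y : int) : prime p -> (0 < j)%N ->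
  (p%:Z ^+ j %| x - y)%Z -> (p%:Z ^+ j.+1 %| x ^+ p - y ^+ p)%Z.
Proof.
move=> p_pr j_gt0 /dvdzP[c cE].
have intS (z : int) : z \is a Num.int by rewrite -[z]intz intr_int.
have [T _ TE] := exprD_prime _ _ y (c * p%:Z ^+ j) p p_pr (intS _) (intS _).
have -> : x = y + c * p%:Z ^+ j by rewrite -cE addrC subrK.
apply/dvdzP; case: j j_gt0 {x cE} TE => // j _.
case: p p_pr => [|[|p]] // _; set q : int := Posz _ => /= ->.
exists (y ^+ p.+1 * c + c ^+ 2 * q ^+ j.+1 * T
   + c ^+ p.+2 * q ^+ j * q ^+ (p * j.+1)).
rewrite !exprMn (natz p.+2) -/q.
have -> : q ^+ j.+1 ^+ p.+2 = q ^+ j.+2 * q ^+ j * q ^+ (p * j.+1).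
  by rewrite -!exprM -!exprD; congr (_ ^+ _); lia.
have -> : q ^+ j.+2 = q * q ^+ j.+1 by rewrite exprS.
by ring.
Qed.

Lemma dvdz_fermat_pow p s (a : int) : prime p ->
  (p%:Z %| a ^+ (p ^ s) - a)%Z.
Proof.
move=> p_pr; elim: s => [|s IHs]; first by rewrite subrr dvdz0.
rewrite expnSr exprM -(subrKA (a ^+ p)).
rewrite rpredD ?dvdz_fermat //.
have /dvdzP[q ->] := dvdz_subXp p 1 _ _ p_pr isT IHs.
by rewrite exprS mulrCA dvdz_mulr.
Qed.

Lemma ratr_poly_overP p (g : {poly rat}) :
  reflect (forall i, ratr g`_i \in pint p) (ratr_poly g \is a polyOver (pint p)).
Proof.
apply: (iffP polyOverP) => gP i; first by have := gP i; rewrite coef_map.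
by rewrite coef_map; apply: gP.
Qed.

Lemma eisenstein_shift p e (z w t : algC) (b u : int) (g : {poly rat}) :
  prime p -> (0 < e)%N ->
  z \in pint p -> w \in pint p -> t \in pint p -> coprime `|u| p ->
  (z - b%:~R) ^+ e = p%:R * (u%:~R + (z - b%:~R) * w + p%:R * t) ->
  (size g <= e)%N -> (ratr_poly g).[z] \in pint p ->
  ratr_poly g \is a polyOver (pint p).
Proof.
move=> p_pr e_gt0 zS wS tS up zE sz_g gS.
have bS : b%:~R \in pint p := Aint_pint _ _ (Aint_int b).
pose g' := g \Po ('X + b%:~R%:P).
have g'E : ratr_poly g' = ratr_poly g \Po ('X + b%:~R%:P).
  by rewrite map_comp_poly rmorphD /= map_polyX map_polyC /= ratr_int.
have gE : ratr_poly g = ratr_poly g' \Po ('X - b%:~R%:P).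
  rewrite g'E -comp_polyA comp_polyD comp_polyX comp_polyC subrK.
  by rewrite comp_polyXr.
rewrite gE polyOver_comp ?polyOverXsubC //; apply/ratr_poly_overP.
apply: (eisenstein_rat p e (z - b%:~R) w t u) => //.
- by rewrite rpredB.
- by rewrite size_comp_poly2 // size_XaddC.
- by rewrite g'E horner_comp hornerD hornerX hornerC subrK.
Qed.

Lemma pint_const p (g : {poly rat}) z : (size g <= 1)%N ->
  (ratr_poly g).[z] \in pint p -> ratr_poly g \is a polyOver (pint p).
Proof.
move=> /size1_polyC ->; rewrite map_polyC hornerC => cS.
by rewrite polyOverC.
Qed.

(** Take pi = z - a and n = p^s. Modulo p pi, the power pi^n is a - a^n; moreover a^n = a^p modulo
    p^2, so p divides a - a^n exactly once. *)
Lemma eisenstein_root p s (z : algC) (a : int) (g : {poly rat}) :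
  prime p -> (0 < s)%N -> ~~ (p%:Z ^+ 2 %| a ^+ p - a)%Z ->
  z ^+ (p ^ s) = a%:~R -> (size g <= p ^ s)%N ->
  (ratr_poly g).[z] \in pint p -> ratr_poly g \is a polyOver (pint p).
Proof.
move=> p_pr s_gt0 p2a zE sz_g gS.
have n_gt0 : (0 < p ^ s)%N by rewrite expn_gt0 prime_gt0.
have aS : a%:~R \in pint p := Aint_pint _ _ (Aint_int a).
have zS : z \in pint p by apply: pint_expn_cancel n_gt0 _; rewrite zE.
have [T TS TE] := exprD_prime_pow _ (pint p) (z - a%:~R) a%:~R p s p_pr
  (rpredB zS aS) aS.
have /dvdzP[u uE] := dvdz_fermat_pow p s a p_pr.
have up : coprime `|u| p.
  rewrite prime_coprimeC //; apply: contra p2a => pu.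
  have : (p%:Z ^+ 2 %| a ^+ (p ^ s) - a)%Z.
    by rewrite uE expr2 dvdz_mul // dvdzE.
  suff h : (p%:Z ^+ 2 %| a ^+ (p ^ s) - a ^+ p)%Z.
    by rewrite -(subrKA (a ^+ p)) rpredDl.
  rewrite -(prednK s_gt0) expnSr exprM.
  by apply: dvdz_subXp => //; apply: dvdz_fermat_pow.
apply: (eisenstein_shift p (p ^ s) z (- T) 0 a (- u)) => //.
- by rewrite rpredN.
- exact: rpred0.
- by rewrite abszN.
have /(congr1 (intr : int -> algC)) := uE.
rewrite rmorphB rmorphM rmorphXn /= -[(Posz p)%:~R]/(p%:R) => uE'.
move: TE; rewrite subrK zE rmorphN /= => TE.
apply: (addIr (a%:~R ^+ (p ^ s) + p%:R * (z - a%:~R) * T)).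
by rewrite addrA -TE -[a%:~R ^+ _](subrK a%:~R) uE'; ring.
Qed.

(** * The cyclotomic factor of X^n - b^p *)

Lemma subrXXS_in (R : comNzRingType) (S : subringClosed R) (x y : R) m :
  x \in S -> y \in S ->
  exists2 q, q \in S & x ^+ m.+1 - y ^+ m.+1 = (x - y) * (x ^+ m + y * q).
Proof.
move=> xS yS; have [q qS qE] := subrXX_in _ _ _ _ m xS yS; exists q => //.
rewrite mulrDr [_ * (y * q)]mulrCA -qE !exprS; ring.
Qed.

(* With [y = z ^+ h] the hypotheses say that [y / b] is a primitive [p]-th root
   of unity. *)
Lemma eisenstein_cyclotomic_odd p s (z : algC) (b : int) (g : {poly rat}) :
  prime p -> (2 < p)%N -> coprime `|b| p ->
  z ^+ (p ^ s.+1) = b%:~R ^+ p -> z ^+ (p ^ s) != b%:~R ->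
  (size g <= p.-1 * p ^ s)%N ->
  (ratr_poly g).[z] \in pint p -> ratr_poly g \is a polyOver (pint p).
Proof.
move=> p_pr p_gt2 bp zE zNb sz_g gS.
(* Oddness makes p - 2 = m + 1 positive, so that the factor d^(m+1) below is a multiple of z - b
   modulo p. *)
have [m pE] : exists m, p = m.+3 by exists (p - 3)%N; lia.
have p_gt0 := prime_gt0 p_pr.
have pn0 : p%:R != 0 :> algC by rewrite pnatr_eq0 -lt0n.
have bS : b%:~R \in pint p := Aint_pint _ _ (Aint_int b).
have zS : z \in pint p.
  apply: (@pint_expn_cancel _ _ (p ^ s.+1)); first by rewrite expn_gt0 p_gt0.
  by rewrite zE rpredX.
pose y := z ^+ (p ^ s); pose d := y - b%:~R.
have d_neq0 : d != 0 by rewrite subr_eq0.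
have dS : d \in pint p by rewrite rpredB ?rpredX.
have [T TS TE] := exprD_prime _ (pint p) b%:~R d p p_pr bS dS.
(* Expand (b + d)^p = b^p and cancel the nonzero d: this is the Eisenstein equation of a primitive
   p-th root of unity minus 1, scaled by b. *)
have dE : d ^+ p.-1 = - p%:R * b%:~R ^+ p.-1 - p%:R * d * T.
  apply: (mulfI d_neq0); rewrite -exprS prednK //.
  apply: (addrI (b%:~R ^+ p + p%:R * b%:~R ^+ p.-1 * d + p%:R * d ^+ 2 * T)).
  by rewrite -TE /d addrC subrK /y -exprM -expnSr zE; ring.
have [h hE] : exists h, (p ^ s = h.+1)%N.
  by exists (p ^ s).-1; rewrite prednK // expn_gt0 p_gt0.
have [T1 T1S T1E] := exprD_prime_pow _ (pint p) (z - b%:~R) b%:~R p s p_pr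
  (rpredB zS bS) bS.
have /dvdzP[v0 v0E] := dvdz_fermat_pow p s b p_pr.
have {}v0E : b%:~R ^+ (p ^ s) = b%:~R + p%:R * v0%:~R :> algC.
  by rewrite -rmorphXn -[_ ^+ _](subrK b) v0E rmorphD rmorphM /= addrC mulrC.
set x := z - b%:~R in T1E *.
have xS : x \in pint p by rewrite rpredB.
pose v := v0%:~R + x * T1.
have vS : v \in pint p.
  by rewrite rpredD ?rpredM //; apply/Aint_pint/Aint_int.
(* Modulo p, d is the p^s-th power of x = z - b, so the equation of d becomes one of degree (p - 1)
   p^s for x. The correction is p v (d^(m+1) + A R), where A and d^m (A + p v) are multiples of x
   modulo p. *)
have dxE : d = x ^+ h.+1 + p%:R * v.
  by rewrite /d /y -(subrK b%:~R z) -/x T1E v0E hE /v; ring.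
pose A := x ^+ h.+1.
have AS : A \in pint p by rewrite rpredX.
have [R RS RE] := subrXXS_in _ (pint p) d A m.+1 dS AS.
apply: (eisenstein_shift p (p.-1 * p ^ s) z
  (x ^+ h * (- T - v * d ^+ m - v * R)) (- v * T - v ^+ 2 * d ^+ m)
  b (- b ^+ p.-1)) => //.
- by rewrite muln_gt0 expn_gt0 p_gt0 andbT -subn1 subn_gt0 prime_gt1.
- by rewrite !(rpredM, rpredB, rpredN, rpredX).
- by rewrite !(rpredM, rpredB, rpredN, rpredX).
- by rewrite abszN abszX coprimeXl.
rewrite -/x mulnC exprM hE -/A rmorphN rmorphXn /=.
have xh : x * x ^+ h = A by rewrite -exprS.
have dm : d ^+ m.+1 = d ^+ m * (A + p%:R * v) by rewrite exprSr {2}dxE.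
have -> : A ^+ p.-1 = d ^+ p.-1 - (d - A) * (d ^+ m.+1 + A * R).
  by move: RE; rewrite pE /= => <-; rewrite subKr.
have dA : d - A = p%:R * v by rewrite dxE /A; ring.
rewrite dE dm dA mulrA xh {1}dxE -/A; ring.
Qed.

(** For p = 2 the factor is X^h + b with h = 2^s, and b = 1 modulo 4 gives (-b)^2 - (-b) = b (b + 1)
    = 2 modulo 4, which is what [eisenstein_root] asks of -b. *)
Lemma eisenstein_cyclotomic p s (z : algC) (b : int) (g : {poly rat}) :
  prime p -> coprime `|b| p -> (p = 2 -> (4 %| b - 1)%Z) ->
  z ^+ (p ^ s.+1) = b%:~R ^+ p -> z ^+ (p ^ s) != b%:~R ->
  (size g <= p.-1 * p ^ s)%N ->
  (ratr_poly g).[z] \in pint p -> ratr_poly g \is a polyOver (pint p).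
Proof.
move=> p_pr bp b2 zE zNb sz_g gS.
have [p_gt2|p_le2] := ltnP 2 p.
  exact: (eisenstein_cyclotomic_odd p s z b g).
have p2 : p = 2 by have := prime_gt1 p_pr; lia.
subst p; have {}zE : z ^+ (2 ^ s) = (- b)%:~R.
  apply/eqP; rewrite rmorphN /= -addr_eq0.
  have /eqP : z ^+ (2 ^ s) ^+ 2 - b%:~R ^+ 2 = 0.
    by rewrite -exprM -expnSr zE subrr.
  by rewrite subr_sqr mulf_eq0 subr_eq0 (negPf zNb).
rewrite mul1n in sz_g; case: s => [|s] in zE zNb sz_g *.
  exact: pint_const gS.
apply: (eisenstein_root 2 s.+1 z (- b)) => //.
have /dvdzP[c cE] := b2 erefl.
have bE : b = c * 4 + 1 by rewrite -cE subrK.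
by rewrite bE; apply/negP => /dvdzP[k]; rewrite !expr2; nia.
Qed.

(** * Approximating [a] by [p]-th powers *)

Lemma pint_horner_sub p M (g : {poly rat}) (x y : algC) :
  (forall i, p%:R ^+ M * ratr g`_i \in pint p) ->
  x \in pint p -> y \in pint p ->
  exists2 q, q \in pint p &
    p%:R ^+ M * ((ratr_poly g).[x] - (ratr_poly g).[y]) = (x - y) * q.
Proof.
move=> MP xS yS; rewrite !(horner_ratr _ _ _ (leqnn _)) -sumrB big_distrr /=.
pose qi i := \sum_(j < i) x ^+ (i.-1 - j) * y ^+ j.
exists (\sum_(i < size g) p%:R ^+ M * ratr g`_i * qi i).
  apply: rpred_sum => i _; rewrite rpredM //; apply: rpred_sum => j _.
  by rewrite rpredM ?rpredX.
rewrite big_distrr; apply: eq_bigr => i _.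
by rewrite /= -mulrBr subrXX -/(qi i); ring.
Qed.

(* If [z ^+ n = b] then [y = g.[z]] satisfies
   [\prod_(z0 ^+ n = a) (y - g.[z0]) = (b - a) * q] where the denominator of [q]
   divides a power of [p] that does not depend on [b]. *)
Lemma pint_root_continuity p n (a : int) (g : {poly rat}) :
  prime p -> (0 < n)%N ->
  (forall z : algC, z ^+ n = a%:~R -> (ratr_poly g).[z] \in pint p) ->
  exists M, forall b : int, (p%:Z ^+ M %| b - a)%Z ->
    forall z : algC, z ^+ n = b%:~R -> (ratr_poly g).[z] \in pint p.
Proof.
move=> p_pr n_gt0 gP; have [M MP] := pint_bounded_denominator p g p_pr.
have [r rE] := closed_field_poly_normal ('X^n - a%:~R%:P : {poly algC}).
rewrite lead_coefXnsubC // scale1r in rE.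
have rootS (b : int) z : z ^+ n = b%:~R -> z \in pint p.
  move=> zb; apply: (@pint_expn_cancel _ _ n n_gt0).
  by rewrite zb; exact/Aint_pint/Aint_int.
have rP z : z \in r -> z ^+ n = a%:~R.
  rewrite -root_prod_XsubC -rE => /rootP.
  by rewrite hornerD hornerN hornerC hornerXn => /eqP; rewrite subr_eq0 => /eqP.
have r_n : size r = n.
  by apply/succn_inj; rewrite -(size_prod_XsubC r id) -rE size_XnsubC.
(* One factor p^M for each of the n roots of X^n - a. *)
exists (M * n)%N => b /dvdzP[c cE] z zb; have zS := rootS _ _ zb.
set y := (ratr_poly g).[z].
have [q qS qE] : exists2 q, q \in pint p &
    \prod_(z0 <- r) (p%:R ^+ M * (y - (ratr_poly g).[z0]))
    = \prod_(z0 <- r) (z - z0) * q.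
  elim: (r) {rE r_n} rP => [|z0 r' IHr] r'P.
    by exists 1; rewrite ?rpred1 // !big_nil mulr1.
  have [q qS qE] := IHr (fun z zr => r'P z (mem_behead (s := z0 :: r') zr)).
  have z0a := r'P z0 (mem_head _ _).
  have [q0 q0S q0E] := pint_horner_sub p M g z z0 MP zS (rootS _ _ z0a).
  exists (q0 * q); rewrite ?rpredM // !big_cons qE q0E; ring.
have wE : \prod_(z0 <- r) (y - (ratr_poly g).[z0]) = c%:~R * q.
  have pMn0 : p%:R ^+ (M * n) != 0 :> algC.
    by rewrite expf_neq0 // pnatr_eq0 -lt0n prime_gt0.
  apply: (mulfI pMn0); rewrite mulrA [_ * c%:~R]mulrC.
  have <- : (b - a)%:~R = c%:~R * p%:R ^+ (M * n) :> algC.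
    by rewrite cE rmorphM rmorphXn.
  have -> : (b - a)%:~R = \prod_(z0 <- r) (z - z0).
    transitivity ('X^n - a%:~R%:P : {poly algC}).[z].
      by rewrite hornerD hornerN hornerC hornerXn zb rmorphB.
    rewrite rE horner_prod; apply: eq_bigr => i _.
    by rewrite hornerXsubC.
  by rewrite -qE big_split /= big_const_seq count_predT iter_mulr_1 r_n exprM.
pose h := \prod_(z0 <- r) ('X - (ratr_poly g).[z0]%:P) - (c%:~R * q)%:P.
have sz_prod : size (\prod_(z0 <- r) ('X - (ratr_poly g).[z0]%:P)) = n.+1.
  by rewrite size_prod_XsubC r_n.
apply: (@pint_root_monic _ h).
- rewrite monicE lead_coefDl; first by apply: (monic_prod_XsubC r).
  by rewrite sz_prod size_polyN (leq_ltn_trans (size_polyC_leq1 _)).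
- apply: rpredB; last first.
    by rewrite polyOverC rpredM //; apply/Aint_pint/Aint_int.
  rewrite big_seq; apply: rpred_prod => z0 z0r.
  by rewrite polyOverXsubC gP // rP.
- apply/rootP; rewrite hornerD hornerN hornerC horner_prod -wE.
  apply/eqP; rewrite subr_eq0; apply/eqP; apply: eq_bigr => i _.
  by rewrite hornerXsubC.
Qed.

Lemma dvdz_fermat_sub1 p (b : int) : prime p -> coprime `|b| p ->
  (p%:Z %| b ^+ p.-1 - 1)%Z.
Proof.
move=> p_pr bp; have := dvdz_fermat p b p_pr.
have -> : b ^+ p - b = b * (b ^+ p.-1 - 1).
  by rewrite mulrBr mulr1 -exprS prednK // prime_gt0.
by rewrite Gauss_dvdzr // coprimezE coprime_sym.
Qed.

Lemma coprime_dvdz_subX p k (a b : int) : prime p -> (0 < k)%N ->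
  coprime `|a| p -> (p%:Z %| b ^+ k - a)%Z -> coprime `|b| p.
Proof.
move=> p_pr k_gt0; rewrite !prime_coprimeC // => pa pba; apply: contra pa => pb.
have pbz : (p%:Z %| b ^+ k)%Z.
  by rewrite -(prednK k_gt0) exprS dvdz_mulr // dvdzE.
suff : (p%:Z %| a)%Z by rewrite dvdzE.
by rewrite -(subKr (b ^+ k) a) rpredB.
Qed.

(** Newton iteration for X^p - a: if b^p = a + c p^(m+2), then b - c p^(m+1) is a root modulo
    p^(m+3), since b^(p-1) = 1 modulo p. *)
Lemma padic_prime_root p M (a : int) : prime p -> coprime `|a| p ->
  (p%:Z ^+ 2 %| a ^+ p - a)%Z -> (p = 2 -> (8 %| a - 1)%Z) ->
  exists b : int, (p%:Z ^+ M %| b ^+ p - a)%Z.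
Proof.
(* The starting precision: b = a works modulo p^2, and for p = 2, b = 1 works modulo 8. The higher
   start for p = 2 ensures p (m + 1) >= m + 3, so that the p-th power of the correction is
   negligible. *)
move=> p_pr ap a2 a8; pose m0 : nat := (if p == 2 then 3 else 2)%N.
suff [b bP] : exists b : int, (p%:Z ^+ (m0 + M) %| b ^+ p - a)%Z.
  exists b; case/dvdzP: bP => c ->; rewrite exprD.
  by rewrite mulrA dvdz_mull.
elim: M => [|M [b /dvdzP[c cE]]].
  rewrite addn0 /m0; case: eqP => [p2|_]; last by exists a.
  exists 1; have := a8 p2; rewrite p2 expr1n -[1 - a]opprB.
  by rewrite rpredN.
have p_gt1 := prime_gt1 p_pr.
have [m mE] : exists m, (m0 + M = m.+2)%N.
  by exists (m0 + M - 2)%N; rewrite /m0; case: eqP; lia.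
rewrite addnS; rewrite mE in cE *.
have pE : (m.+3 <= p * m.+1)%N.
  by move: mE; rewrite /m0; case: eqP => [->|]; nia.
have bp : coprime `|b| p.
  apply: (@coprime_dvdz_subX p p a) => //; rewrite ?prime_gt0 // cE exprS.
  by rewrite mulrCA dvdz_mulr.
have /dvdzP[l lE] := dvdz_fermat_sub1 p b p_pr bp.
have intS (z : int) : z \is a Num.int by rewrite -[z]intz intr_int.
have [T _ TE] := exprD_prime _ _ b (- c * p%:Z ^+ m.+1) p p_pr (intS _) (intS _).
exists (b + - c * p%:Z ^+ m.+1); rewrite TE natz.
have -> : (- c * p%:Z ^+ m.+1) ^+ p
    = (- c) ^+ p * (p%:Z ^+ m.+3 * p%:Z ^+ (p * m.+1 - m.+3)).
  by rewrite exprMn -exprM -exprD subnKC // mulnC.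
apply/dvdzP; exists (- c * l + c ^+ 2 * p%:Z ^+ m * T
  + (- c) ^+ p * p%:Z ^+ (p * m.+1 - m.+3)).
have -> : b ^+ p = a + c * p%:Z ^+ m.+2 by rewrite -cE addrC subrK.
have -> : b ^+ p.-1 = l * p%:Z + 1 by rewrite -lE subrK.
by rewrite !exprS; ring.
Qed.

(** * The unramified case [p = 2], [a = 5] modulo 8 *)

Lemma pint_half_int (m : int) : ratr (m%:~R / 2) \in pint 2 -> (2 %| m)%Z.
Proof.
case/pint_ratP=> N N2 /intrP[l lE].
have e : N%:Z * m = l * 2.
  apply: (@intr_inj rat); rewrite !rmorphM /= -lE.
  by rewrite -[N%:~R]/(N%:R) -[2%:~R]/(2%:R); field.
rewrite -(@Gauss_dvdzr 2 N); last by rewrite coprimezE coprime_sym.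
by rewrite e dvdz_mull.
Qed.

Lemma pint_rat_half (x : rat) N (m : int) : coprime N 2 ->
  N%:R * x = m%:~R -> (2 %| m)%Z -> ratr x / 2%:R \in pint 2.
Proof.
move=> N2 mE /dvdzP[l lE]; rewrite -(ratr_nat algC) -fmorph_div /=.
apply/pint_ratP; exists N => //.
by rewrite mulrA mE lE rmorphM /= mulfK // intr_int.
Qed.

(* The norm form of the unramified quadratic extension of [Q_2] is anisotropic
   modulo 2. *)
Lemma pint_unramified_norm (x y : rat) (k : int) : ~~ (2 %| k)%Z ->
  ratr x \in pint 2 -> ratr y \in pint 2 ->
  ratr (x ^+ 2 + x * y - k%:~R * y ^+ 2) / 2%:R \in pint 2 ->
  ratr x / 2%:R \in pint 2 /\ ratr y / 2%:R \in pint 2.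
Proof.
move=> kodd /pint_ratP[N N2 /intrP[m mE]] /pint_ratP[N' N'2 /intrP[l lE]] normS.
have NN2 : coprime (N * N') 2 by rewrite coprimeMl N2.
have [X XE] : exists X : int, (N * N')%:R * x = X%:~R.
  by exists (m * N'%:Z); rewrite intrM -mE natrM -[N'%:~R]/(N'%:R); ring.
have [Y YE] : exists Y : int, (N * N')%:R * y = Y%:~R.
  by exists (l * N%:Z); rewrite intrM -lE natrM -[N%:~R]/(N%:R); ring.
have : (2 %| X ^+ 2 + X * Y - k * Y ^+ 2)%Z.
  apply: pint_half_int; set D := (N * N')%:R in XE YE.
  have -> : (X ^+ 2 + X * Y - k * Y ^+ 2)%:~R / 2
     = D ^+ 2 * ((x ^+ 2 + x * y - k%:~R * y ^+ 2) / 2) :> rat.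
    by rewrite intrB intrD !expr2 !intrM -XE -YE; ring.
  rewrite rmorphM rmorphXn fmorph_div /= !ratr_nat.
  by rewrite rpredM ?rpredX ?rpred_nat.
have half j : exists t e : int, j = t * 2 + e /\ (e = 0 \/ e = 1).
  exists (j %/ 2)%Z, (j %% 2)%Z; split; first exact: divz_eq.
  have := modz_ge0 j (isT : 2 != 0 :> int).
  by have := ltz_pmod j (isT : 0 < 2 :> int); lia.
have [X1 [X0 [XE' X0P]]] := half X; have [Y1 [Y0 [YE' Y0P]]] := half Y.
have [k1 [k0 [kE' k0P]]] := half k.
move=> /dvdzP[t tE].
have k01 : k0 = 1.
  case: k0P => // k00; case/negP: kodd; apply/dvdzP; exists k1; lia.
have e : exists t', X0 ^+ 2 + X0 * Y0 - Y0 ^+ 2 = t' * 2.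
  exists (t - (2 * X1 ^+ 2 + 2 * X1 * X0 + 2 * X1 * Y1 + X1 * Y0 + X0 * Y1
     - k1 * Y ^+ 2 - 2 * Y1 ^+ 2 - 2 * Y1 * Y0)).
  by rewrite mulrBl -tE kE' k01 XE' YE'; ring.
case: e => t' t'E.
have [X00 Y00] : X0 = 0 /\ Y0 = 0.
  by case: X0P t'E => ->; case: Y0P => -> //; rewrite !expr2; lia.
split; [apply: (pint_rat_half _ _ _ NN2 XE)|apply: (pint_rat_half _ _ _ NN2 YE)].
- by apply/dvdzP; exists X1; rewrite XE' X00 addr0.
- by apply/dvdzP; exists Y1; rewrite YE' Y00 addr0.
Qed.

(** The Eisenstein argument over Z[om] localized at 2, with coefficients U_i + om V_i. As k is odd,
    2 is inert there, and the role of the integer unit is taken by om - 1, whose norm is -k. *)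
Lemma eisenstein_unramified e (pi w t om : algC) (k : int) (U V : {poly rat}) :
  (0 < e)%N -> ~~ (2 %| k)%Z -> om ^+ 2 = om + k%:~R ->
  pi \in pint 2 -> w \in pint 2 -> t \in pint 2 ->
  pi ^+ e = 2%:R * (om - 1 + pi * w + 2%:R * t) ->
  (size U <= e)%N -> (size V <= e)%N ->
  (ratr_poly U).[pi] + om * (ratr_poly V).[pi] \in pint 2 ->
  ratr_poly U \is a polyOver (pint 2) /\ ratr_poly V \is a polyOver (pint 2).
Proof.
move=> e_gt0 kodd omE piS wS tS piE sU sV UVS.
have kS : k%:~R \in pint 2 := Aint_pint _ _ (Aint_int k).
have omS : om \in pint 2.
  apply: (@pint_root_monic _ ('X^2 - ('X + k%:~R%:P))).
  - rewrite monicE lead_coefDl ?lead_coefXn //.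
    by rewrite size_polyN size_polyXn size_XaddC.
  - by rewrite rpredB ?rpredX ?polyOverX // rpredD ?polyOverX ?polyOverC.
  - by apply/rootP; rewrite hornerD hornerN hornerXn hornerD hornerX hornerC omE subrr.
have [MU MUP] := pint_bounded_denominator 2 U isT.
have [MV MVP] := pint_bounded_denominator 2 V isT.
suff UVP : forall M,
    (forall i, 2%:R ^+ M * ratr U`_i \in pint 2) ->
    (forall i, 2%:R ^+ M * ratr V`_i \in pint 2) ->
    (forall i, ratr U`_i \in pint 2) /\ (forall i, ratr V`_i \in pint 2).
  have [||UP VP] := UVP (MU + MV)%N.
  - by move=> i; rewrite addnC exprD -mulrA rpredM ?rpredX ?rpred_nat.
  - by move=> i; rewrite exprD -mulrA rpredM ?rpredX ?rpred_nat.
  - by split; apply/ratr_poly_overP.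
elim=> [|M IHM] UP VP.
  by split=> i; [have := UP i | have := VP i]; rewrite expr0 mul1r.
pose P i := 2%:R ^+ M * ratr U`_i \in pint 2 /\ 2%:R ^+ M * ratr V`_i \in pint 2.
suff PP : forall i, (i < e)%N -> P i.
  apply: IHM => i; (have [/PP[]//|ei] := ltnP i e);
    by rewrite nth_default ?(leq_trans _ ei) // rmorph0 mulr0 rpred0.
have two_half (x : algC) : 2%:R ^+ M.+1 * x / 2%:R = 2%:R ^+ M * x.
  by rewrite exprS; field.
pose c i := 2%:R ^+ M.+1 * ratr U`_i + om * (2%:R ^+ M.+1 * ratr V`_i) : algC.
have cE i : c i / 2%:R = 2%:R ^+ M * ratr U`_i + om * (2%:R ^+ M * ratr V`_i).
  by rewrite /c mulrDl -[om * _ / _]mulrA !two_half.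
apply: (@eisenstein_coefs 2 e pi (om - 1) w t c) => //.
- by rewrite rpredB ?rpred1.
- by move=> i _; rewrite rpredD // rpredM.
- by move=> i _ [UPi VPi]; rewrite cE rpredD // rpredM.
- move=> i _ cS.
  have [x xE] : exists x, ratr x = 2%:R ^+ M.+1 * ratr U`_i :> algC.
    by exists (2%:R ^+ M.+1 * U`_i); rewrite rmorphM rmorphXn /= ratr_nat.
  have [y yE] : exists y, ratr y = 2%:R ^+ M.+1 * ratr V`_i :> algC.
    by exists (2%:R ^+ M.+1 * V`_i); rewrite rmorphM rmorphXn /= ratr_nat.
  rewrite /P -!two_half -xE -yE.
  have xS : ratr x \in pint 2 by rewrite xE.
  have yS : ratr y \in pint 2 by rewrite yE.
  apply: (pint_unramified_norm x y k) => //.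
  have normE : ratr (x ^+ 2 + x * y - k%:~R * y ^+ 2)
      = ratr x ^+ 2 + ratr x * ratr y - k%:~R * ratr y ^+ 2 :> algC.
    by rewrite !expr2 rmorphB rmorphD !rmorphM /= ratr_int.
  apply: (pint_prime_dvdX _ e) => //.
    rewrite normE; apply: rpredB (rpredD (rpredX 2 xS) (rpredM xS yS)) _.
    exact: rpredM kS (rpredX 2 yS).
  (* Multiplication by the conjugate under om -> 1 - om turns the coefficient into its norm form,
     and om - 1 into (om - 1)(- om) = -k. *)
  apply: (@pint_int_cancel _ ((- k) ^+ (e * e.-1))).
    by rewrite abszX coprimeXl // abszN prime_coprimeC //; rewrite dvdzE in kodd.
  have conjS : (ratr x + (1 - om) * ratr y) ^+ e * (- om) ^+ (e * e.-1) \in pint 2.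
    apply: rpredM; last by rewrite rpredX ?rpredN.
    by apply/rpredX/(rpredD xS)/rpredM => //; rewrite rpredB ?rpred1.
  have := rpredM cS conjS; rewrite /c -xE -yE => ccS.
  rewrite [X in X \in _](_ : _ = (ratr x + om * ratr y) ^+ e
     * (om - 1) ^+ (e * e.-1) / 2%:R
     * ((ratr x + (1 - om) * ratr y) ^+ e * (- om) ^+ (e * e.-1))) //.
  have -> : ratr (x ^+ 2 + x * y - k%:~R * y ^+ 2)
     = (ratr x + om * ratr y) * (ratr x + (1 - om) * ratr y) :> algC.
    rewrite normE.
    have -> : k%:~R = om ^+ 2 - om :> algC by rewrite omE addrAC subrr add0r.
    by ring.
  have -> : ((- k) ^+ (e * e.-1))%:~R
     = (om - 1) ^+ (e * e.-1) * (- om) ^+ (e * e.-1) :> algC.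
    rewrite rmorphXn rmorphN /= -exprMn; congr (_ ^+ _).
    have -> : k%:~R = om ^+ 2 - om :> algC by rewrite omE addrAC subrr add0r.
    by ring.
  by rewrite [(_ * (_ + _ * ratr y)) ^+ e]exprMn; ring.
- have -> : (\sum_(i < e) c i * pi ^+ i) / 2%:R
     = 2%:R ^+ M * ((ratr_poly U).[pi] + om * (ratr_poly V).[pi]).
    rewrite !(horner_ratr _ e) // big_distrl /= !big_distrr /= -big_split /=.
    rewrite big_distrr; apply: eq_bigr => i _ /=.
    by rewrite mulrAC cE; ring.
  by rewrite rpredM ?rpredX ?rpred_nat.
Qed.

(** With h = 2^s and om = (1 + z^h) / 2, splitting g = A + B X^h gives g(z) = (A - B)(z) + om (2
    B)(z), and z - 1 is Eisenstein of degree h over Z[om]. Hence A - B and 2 B are 2-integral: the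
    denominators at 2 are at most 2, and trivial if B = 0. *)
Lemma pint_double_coefs s (z : algC) (a : int) (g : {poly rat}) :
  (4 %| a - 1)%Z -> ~~ (8 %| a - 1)%Z -> z ^+ (2 ^ s.+1) = a%:~R ->
  (size g <= 2 ^ s.+1)%N -> (ratr_poly g).[z] \in pint 2 ->
  (forall i, 2%:R * ratr g`_i \in pint 2) /\
  ((size g <= 2 ^ s)%N -> forall i, ratr g`_i \in pint 2).
Proof.
move=> /dvdzP[k kE] a8 zE sz_g gS; pose h := (2 ^ s)%N.
have h_gt0 : (0 < h)%N by rewrite expn_gt0.
have kodd : ~~ (2 %| k)%Z.
  apply: contra a8 => /dvdzP[l lE]; apply/dvdzP; exists l.
  by rewrite kE lE -mulrA.
have two0 : 2%:R != 0 :> algC by rewrite pnatr_eq0.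
pose A := take_poly h g; pose B := drop_poly h g.
have gE : g = A + B * 'X^h by rewrite poly_take_drop.
have sA : (size A <= h)%N by rewrite size_take_poly.
have sB : (size B <= h)%N.
  by rewrite size_drop_poly leq_subLR addnn -mul2n -expnS.
pose om := (1 + z ^+ h) / 2%:R.
have zh : z ^+ h = 2%:R * om - 1 by rewrite /om; field.
have omE : om ^+ 2 = om + k%:~R.
  have aE : (z ^+ h) ^+ 2 = 4%:R * k%:~R + 1.
    rewrite -exprM mulnC -expnS zE -[a](subrK 1) kE rmorphD rmorphM /=.
    by rewrite mulrC.
  have -> : k%:~R = ((z ^+ h) ^+ 2 - 1) / 4%:R :> algC.
    by rewrite aE addrK mulrAC mulfV ?mul1r // pnatr_eq0.
  by rewrite /om; field.
have zS : z \in pint 2.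
  apply: (@pint_expn_cancel _ _ (2 ^ s.+1)); first by rewrite expn_gt0.
  by rewrite zE; exact/Aint_pint/Aint_int.
have [T TS TE] := exprD_prime_pow _ (pint 2) (z - 1) 1 2 s isT
  (rpredB zS (rpred1 _)) (rpred1 _).
pose sh := 'X + 1 : {poly rat}.
have shE : ratr_poly sh = 'X + 1 by rewrite rmorphD /= map_polyX rmorph1.
have sz_sh (q : {poly rat}) : size (q \Po sh) = size q.
  by rewrite size_comp_poly2 // size_XaddC.
have sh_hor (q : {poly rat}) : (ratr_poly (q \Po sh)).[z - 1] = (ratr_poly q).[z].
  rewrite map_comp_poly shE horner_comp !hornerE; congr (_.[_]); ring.
have shK (q : {poly rat}) : ratr_poly (q \Po sh) \is a polyOver (pint 2) ->
    ratr_poly q \is a polyOver (pint 2).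
  move=> qS; have -> : ratr_poly q = ratr_poly (q \Po sh) \Po ('X - 1).
    rewrite map_comp_poly shE -comp_polyA comp_polyD comp_polyX comp_polyC.
    by rewrite subrK comp_polyXr.
  by rewrite polyOver_comp // rpredB ?polyOverX ?rpred1.
have [|||||||UP VP] := eisenstein_unramified h (z - 1) (- T) 0 om k
   ((A - B) \Po sh) ((2%:R *: B) \Po sh) h_gt0 kodd omE.
- by rewrite rpredB ?rpred1.
- by rewrite rpredN.
- exact: rpred0.
- move: TE; rewrite subrK expr1n -/h zh => TE.
  by apply: (addIr (1 + 2%:R * (z - 1) * T)); rewrite addrA -TE; ring.
- by rewrite sz_sh (leq_trans (size_polyD _ _)) // size_polyN geq_max sA.
- by rewrite sz_sh (leq_trans (size_scale_leq _ _)).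
- rewrite !sh_hor (_ : _ + _ = (ratr_poly g).[z]) // gE.
  have -> : (ratr_poly (A + B * 'X^h)).[z]
      = (ratr_poly A).[z] + (ratr_poly B).[z] * z ^+ h.
    by rewrite rmorphD /= rmorphM /= map_polyXn hornerD hornerM hornerXn.
  rewrite map_polyZ /= ratr_nat hornerZ rmorphB /= hornerD hornerN zh; ring.
have {}VP := shK _ VP; have {}UP := shK _ UP.
have B2 i : 2%:R * ratr B`_i \in pint 2.
  by move/ratr_poly_overP/(_ i): VP; rewrite coefZ rmorphM /= ratr_nat.
have AB i : ratr A`_i - ratr B`_i \in pint 2.
  by move/ratr_poly_overP/(_ i): UP; rewrite coefB rmorphB.
have A2 i : 2%:R * ratr A`_i \in pint 2.
  rewrite -[ratr A`_i](subrK (ratr B`_i)) mulrDr rpredD //.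
  by rewrite rpredM ?rpred_nat.
split=> [i|sg i].
  rewrite gE coefD coefMXn; case: ltnP => _; rewrite ?addr0 //.
  by rewrite rmorphD /= mulrDr; apply: rpredD.
have B0 : B = 0 by apply/eqP; rewrite -size_poly_eq0 size_drop_poly subn_eq0.
by have := AB i; rewrite gE B0 mul0r addr0 coef0 rmorph0 subr0.
Qed.

(** * Denominators at [p] when [p] does not divide [a] *)

Lemma dvdz_subXX (d x y : int) n : (d %| x - y)%Z -> (d %| x ^+ n - y ^+ n)%Z.
Proof. by move=> xy; rewrite subrXX dvdz_mulr. Qed.

Lemma dvdz_expl (d : int) i j : (i <= j)%N -> (d ^+ i %| d ^+ j)%Z.
Proof. by move=> ij; rewrite -(subnKC ij) exprD dvdz_mulr. Qed.

Lemma dvdz_subX_unit p j (a : int) : prime p -> coprime `|a| p ->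
  (p%:Z ^+ j %| a ^+ p - a)%Z = (p%:Z ^+ j %| a ^+ p.-1 - 1)%Z.
Proof.
move=> p_pr ap.
have -> : a ^+ p - a = a * (a ^+ p.-1 - 1).
  by rewrite mulrBr mulr1 -exprS prednK // prime_gt0.
by rewrite Gauss_dvdzr // coprimezE abszX coprime_sym coprimeXr.
Qed.

Lemma dvdz4_odd_sign (b : int) :
  ~~ (2 %| b)%Z -> ~~ (4 %| b - 1)%Z -> (4 %| - b - 1)%Z.
Proof.
have := ltz_pmod b (isT : 0 < 4 :> int); have := modz_ge0 b (isT : 4 != 0 :> int).
rewrite {3 4 5}(divz_eq b 4); move: (b %/ 4)%Z (b %% 4)%Z => c [] // e _ e4.
case: e e4 => [|[|[|[|e]]]] // _ b2 b4.
- by case/negP: b2; apply/dvdzP; exists (c * 2); ring.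
- by case/negP: b4; apply/dvdzP; exists c; ring.
- by case/negP: b2; apply/dvdzP; exists (c * 2 + 1); ring.
- by apply/dvdzP; exists (- c - 1); ring.
Qed.

(* For [p = 2] the sign of the root is chosen so that [X ^+ h + b] is Eisenstein
   at a shift. *)
Lemma padic_prime_root_sign p M (a : int) : prime p -> coprime `|a| p ->
  (p%:Z ^+ 2 %| a ^+ p - a)%Z -> (p = 2 -> (8 %| a - 1)%Z) ->
  exists b : int, [/\ (p%:Z ^+ M.+1 %| b ^+ p - a)%Z, coprime `|b| p
    & p = 2 -> (4 %| b - 1)%Z].
Proof.
move=> p_pr ap a2 a8.
have [b bP] := padic_prime_root p M.+1 a p_pr ap a2 a8.
have bp : coprime `|b| p.
  apply: (coprime_dvdz_subX _ _ _ _ p_pr (prime_gt0 p_pr) ap).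
  by case/dvdzP: bP => c ->; rewrite exprS mulrCA dvdz_mulr.
case: (eqVneq p 2) => [p2|/eqP pn2]; last by exists b.
have [b4|b4] := boolP (4 %| b - 1)%Z; first by exists b.
exists (- b); split=> [||_]; rewrite ?abszN //; first by move: bP; rewrite p2 sqrrN.
apply: dvdz4_odd_sign b4; apply/negP => b2.
by move: bp; rewrite p2 prime_coprimeC // => /negP; apply; rewrite dvdzE in b2.
Qed.

(** D is an upper bound of min(r, s), and the condition on k says that k + 1 exceeds D or is out of
    reach for the degree of f. Each division by [Psi] lowers s, D and k by one, trading a for b and
    f for p times the quotient; since [Psi] is monic, the leading coefficient only gains this p. *)
Lemma pint_lead_coef_pure p s D k (a : int) (f : {poly rat}) :
  prime p -> coprime `|a| p ->
  (s <= D)%N || ~~ (p%:Z ^+ D.+2 %| a ^+ p.-1 - 1)%Z ->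
  (D <= k)%N || (size f <= p ^ s - p ^ (s - k.+1))%N ->
  (size f <= p ^ s)%N ->
  (forall z : algC, z ^+ (p ^ s) = a%:~R -> (ratr_poly f).[z] \in pint p) ->
  p%:R ^+ k * ratr (lead_coef f) \in pint p.
Proof.
move=> p_pr; elim: s D k a f => [|s IHs] D k a f ap aD fk sz_f fP.
  have /ratr_poly_overP fS := pint_const p f _ sz_f (fP a%:~R (expr1 _)).
  by rewrite lead_coefE rpredM ?rpredX ?rpred_nat.
have p_gt0 := prime_gt0 p_pr; have p_gt1 := prime_gt1 p_pr.
have n_gt0 : (0 < p ^ s.+1)%N by rewrite expn_gt0 p_gt0.
have coefsP : ratr_poly f \is a polyOver (pint p) ->
    p%:R ^+ k * ratr (lead_coef f) \in pint p.
  by move=> /ratr_poly_overP fS; rewrite lead_coefE rpredM ?rpredX ?rpred_nat.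
have zE := rootCK n_gt0 (a%:~R : algC).
have zS := fP _ zE; set z := _.-root _ in zE zS.
have [a2|a2] := boolP (p%:Z ^+ 2 %| a ^+ p - a)%Z; last first.
  exact/coefsP/(eisenstein_root p s.+1 z a).
have a2' : (p%:Z ^+ 2 %| a ^+ p.-1 - 1)%Z by rewrite -dvdz_subX_unit.
case: D aD fk => [|D] aD fk; first by rewrite a2' in aD.
have szE : (p ^ s.+1 = p.-1 * p ^ s + p ^ s)%N.
  by rewrite -mulSnr prednK // expnS.
(* For a = 5 modulo 8 no 2-adic square root exists, but denominators are at most 2; and k = 0 forces
   the degree of f below 2^s, where there are none. *)
have [/andP[/eqP p2 a8]|] := boolP ((p == 2) && ~~ (8 %| a - 1)%Z).
  subst p; have a4 : (4 %| a - 1)%Z by exact: a2'.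
  have [f2 f1] := pint_double_coefs s z a f a4 a8 zE sz_f zS.
  case: k fk coefsP => [|k] fk coefsP; last first.
    by rewrite lead_coefE exprSr -mulrA rpredM ?rpredX ?rpred_nat.
  apply/coefsP/ratr_poly_overP/f1.
  by move: fk; rewrite subn1 expnS mul2n -addnn addnK.
rewrite negb_and negbK => a8'.
have a8 : p = 2 -> (8 %| a - 1)%Z by move=> p2; rewrite p2 in a8'.
have [M fM] := pint_root_continuity p _ a f p_pr n_gt0 fP.
(* The precision covers p^M for the continuity, and p^(D+3) for comparing a^(p-1) - 1 with
   (b^p)^(p-1) - 1. *)
have [b [bP bp b4]] := padic_prime_root_sign p (M + D.+2) a p_pr ap a2 a8.
have {fM} fS (y : algC) : y ^+ (p ^ s.+1) = b%:~R ^+ p -> (ratr_poly f).[y] \in pint p.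
  rewrite -rmorphXn => /= yE; apply: fM yE; apply: dvdz_trans bP.
  by rewrite dvdz_expl // leqW // leq_addr.
have h_gt0 : (0 < p ^ s)%N by rewrite expn_gt0 p_gt0.
set h := (p ^ s)%N in h_gt0 szE *.
pose Psi : {poly rat} := \sum_(i < p) ('X^h) ^+ (p.-1 - i) * b%:~R%:P ^+ i.
have PsiE : ('X^h - b%:~R%:P) * Psi = 'X^(p ^ s.+1) - (b%:~R ^+ p)%:P.
  by rewrite -subrXX -exprM -expnSr polyC_exp.
have Psi_mon : Psi \is monic.
  have := congr1 lead_coef PsiE; rewrite lead_coefM !lead_coefXnsubC // mul1r.
  by rewrite monicE => ->.
have sz_Psi : size Psi = (p.-1 * h).+1.
  have := congr1 (fun q : {poly rat} => size q) PsiE.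
  rewrite size_proper_mul ?lead_coefXnsubC ?mul1r ?monic_neq0 ?lead_coef_eq0 //.
    rewrite !size_XnsubC //= szE => /eqP.
    by rewrite addnC -addSn eqn_add2r => /eqP.
  by rewrite monic_neq0.
have Psi_hor (y : algC) : (ratr_poly Psi).[y]
    = \sum_(i < p) (y ^+ h) ^+ (p.-1 - i) * b%:~R ^+ i.
  rewrite rmorph_sum horner_sum; apply: eq_bigr => i _.
  rewrite rmorphM !rmorphXn /= map_polyX map_polyC /= ratr_int.
  by rewrite hornerM !horner_exp hornerX hornerC.
have Psi_b (y : algC) : y ^+ h = b%:~R ->
    (ratr_poly Psi).[y] = p%:R * b%:~R ^+ p.-1.
  move=> yE; rewrite Psi_hor yE mulr_natl.
  rewrite (eq_bigr (fun=> b%:~R ^+ p.-1)) ?sumr_const ?card_ord // => i _.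
  by rewrite -exprD subnK // -ltnS prednK.
have b_neq0 : b%:~R != 0 :> algC.
  by rewrite intr_eq0; apply: contraTneq bp => ->; rewrite prime_coprimeC // dvdn0.
have Psi_root (y : algC) : (ratr_poly Psi).[y] * (y ^+ h - b%:~R)
    = y ^+ (p ^ s.+1) - b%:~R ^+ p.
  by rewrite mulrC Psi_hor -subrXX -exprM -expnSr.
pose q := f %/ Psi; pose r := f %% Psi.
have fE : f = q * Psi + r by exact: divp_eq.
have sz_r : (size r < size Psi)%N by rewrite ltn_modp monic_neq0.
have rS : ratr_poly r \is a polyOver (pint p).
  (* One root of [Psi] suffices: f and r agree there, and y^h differs from b because [Psi] takes the
     nonzero value p b^(p-1) wherever y^h = b. *)
  have [y yP] : exists y, root (ratr_poly Psi) y.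
    apply/closed_rootP; rewrite size_map_poly sz_Psi eqSS muln_eq0 negb_or.
    by rewrite -!lt0n h_gt0 -subn1 subn_gt0 p_gt1.
  have yE : y ^+ (p ^ s.+1) = b%:~R ^+ p.
    by apply/eqP; rewrite -subr_eq0 -Psi_root (rootP yP) mul0r.
  apply: (eisenstein_cyclotomic p s y b) => //.
  - apply: contraL yP => /eqP/Psi_b yb; rewrite rootE yb.
    by rewrite mulf_neq0 ?expf_neq0 // pnatr_eq0 -lt0n.
  - by rewrite -ltnS -sz_Psi.
  - have := fS _ yE; rewrite {1}fE rmorphD rmorphM /= hornerD hornerM.
    by rewrite (rootP yP) mulr0 add0r.
have [q0|q_neq0] := eqVneq q 0.
  by apply: coefsP; rewrite fE q0 mul0r add0r.
have sz_qP : size (q * Psi) = (size q + p.-1 * h)%N.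
  by rewrite size_Mmonic // sz_Psi addnS.
have sz_f' : size f = (size q + p.-1 * h)%N.
  rewrite {1}fE size_polyDl ?sz_qP // (leq_trans sz_r) // sz_Psi.
  by rewrite -add1n leq_add2r lt0n size_poly_eq0.
have lead_f : lead_coef f = lead_coef q.
  rewrite {1}fE lead_coefDl ?lead_coef_Mmonic // sz_qP -sz_f'.
  rewrite (leq_trans sz_r) // sz_f' sz_Psi.
  by rewrite -add1n leq_add2r lt0n size_poly_eq0.
(* For k = 0 the size hypothesis puts the degree of f below that of [Psi], against the nonzero
   quotient. *)
case: k fk coefsP => [|k] fk _.
  move: fk; rewrite subn1 /= -/h szE addnK sz_f' -{2}[(p.-1 * h)%N]add0n.
  by rewrite leq_add2r leqn0 size_poly_eq0 (negPf q_neq0).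
have pn0 : p%:R != 0 :> rat by rewrite pnatr_eq0 -lt0n.
rewrite lead_f exprSr -mulrA -(ratr_nat algC) -rmorphM /= -lead_coefZ ratr_nat.
have bpD : (p%:Z ^+ D.+3 %| (b ^+ p) ^+ p.-1 - a ^+ p.-1)%Z.
  apply: dvdz_subXX; apply: dvdz_trans bP; apply: dvdz_expl.
  by rewrite ltnS leq_addl.
apply: (IHs D k b) => //.
- move: aD; rewrite ltnS; case/orP=> [->//|aD]; apply/orP; right.
  apply: contra aD => bD; have := dvdz_subXp p D.+2 (b ^+ p.-1) 1 p_pr isT bD.
  rewrite expr1n -exprM mulnC exprM => bD'.
  by rewrite -(subrKA ((b ^+ p) ^+ p.-1)) rpredD // -opprB rpredN.
- move: fk; rewrite ltnS; case/orP=> [->//|fk]; apply/orP; right.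
  apply: leq_trans (size_scale_leq _ _) _.
  move: fk; rewrite sz_f' subSS -/h szE => fk.
  rewrite -(leq_add2r (p.-1 * h)) (leq_trans fk) // -addnBA.
    by rewrite addnC.
  by rewrite leq_pexp2l // leq_subr.
- apply: leq_trans (size_scale_leq _ _) _.
  by move: sz_f; rewrite sz_f' szE addnC leq_add2l.
- move=> y yE; have yS : y \in pint p.
    apply: (@pint_expn_cancel _ _ h) => //; rewrite yE.
    exact/Aint_pint/Aint_int.
  have yn : y ^+ (p ^ s.+1) = b%:~R ^+ p by rewrite expnSr exprM yE.
  have := rpredB (fS _ yn) (rpred_horner rS yS).
  rewrite {1}fE rmorphD rmorphM /= hornerD hornerM addrK Psi_b //.
  rewrite map_polyZ hornerZ /= ratr_nat => qS.
  apply: (@pint_int_cancel _ (b ^+ p.-1)).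
    by rewrite abszX coprimeXl.
  have -> : (b ^+ p.-1)%:~R = b%:~R ^+ p.-1 :> algC by rewrite rmorphXn.
  move: qS; rewrite mulrCA => qS; rewrite mulrCA.
  by rewrite [X in p%:R * X]mulrC.
Qed.

(** * Denominators at [q != p], and at [p] when [p] divides [a] *)

Lemma coprime_eqn_mod d e k m : coprime e d ->
  e * k = e * m %[mod d] -> k = m %[mod d].
Proof.
move=> ed; wlog km : k m / (k <= m)%N => [wl ekm|].
  by case: (leqP k m) => [/wl|/ltnW/wl h]; [apply | apply/esym/h/esym].
move/esym/eqP; rewrite eqn_mod_dvd ?leq_mul // -mulnBr Gauss_dvdr 1?coprime_sym //.
by move=> dkm; apply/esym/eqP; rewrite eqn_mod_dvd.
Qed.

(** Fourier inversion over the roots x^i z isolates n f_m z^m; the n-th power then removes the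
    dependence on z. *)
Lemma pint_homogeneous q n (a : int) (f : {poly rat}) :
  (0 < n)%N -> coprime n q -> (size f <= n)%N ->
  (forall z : algC, z ^+ n = a%:~R -> (ratr_poly f).[z] \in pint q) ->
  forall m, ratr f`_m ^+ n * a%:~R ^+ m \in pint q.
Proof.
move=> n_gt0 nq sz_f fP m.
have [m_lt|m_ge] := ltnP m n; last first.
  by rewrite nth_default ?(leq_trans sz_f) // rmorph0 expr0n gtn_eqF // mul0r rpred0.
have zE := rootCK n_gt0 (a%:~R : algC); set z := _.-root _ in zE.
suff fmS : ratr f`_m * z ^+ m \in pint q.
  by rewrite -zE -exprM mulnC exprM -exprMn rpredX.
have [x x_prim] := C_prim_root_exists n_gt0.
apply: (@pint_nat_cancel _ n) => //.
have -> : n%:R * (ratr f`_m * z ^+ m)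
    = \sum_(i < n) x ^+ (i * (n - m)) * (ratr_poly f).[x ^+ i * z].
  under eq_bigr => i _ do rewrite (horner_ratr _ n) // big_distrr /=.
  rewrite exchange_big (bigD1 (Ordinal m_lt)) //= [X in _ + X]big1 ?addr0.
    rewrite (eq_bigr (fun=> ratr f`_m * z ^+ m)).
      by rewrite sumr_const card_ord mulr_natl.
    move=> i _; have xi : x ^+ (i * (n - m)) * x ^+ i ^+ m = 1.
      rewrite -exprM -exprD -mulnDr subnK 1?ltnW // mulnC exprM.
      by rewrite (prim_expr_order x_prim) expr1n.
    by rewrite exprMn -[RHS]mul1r -xi; ring.
  move=> j; rewrite -val_eqE /= => jm.
  (* For j other than m, n does not divide n - m + j, so [y] is an n-th root of unity other than 1
     and its powers sum to 0. *)
  pose y := x ^+ (n - m + j).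
  rewrite (eq_bigr (fun i : 'I_n => ratr f`_j * z ^+ j * y ^+ i)).
    rewrite -big_distrr /=; suff -> : \sum_(i < n) y ^+ i = 0 by rewrite mulr0.
    apply/eqP; have yn : y ^+ n = 1.
      by rewrite -exprM mulnC exprM (prim_expr_order x_prim) expr1n.
    have := subrX1 y n; rewrite yn subrr => /esym/eqP.
    rewrite mulf_eq0 subr_eq0 => /orP[|//].
    rewrite -(prim_order_dvd x_prim) => /dvdnP[k kE].
    have jn := ltn_ord j; case/eqP: jm.
    case: k kE => [|[|k]] kE; first by lia.
      by lia.
    by move: kE; rewrite !mulSn; move: (k * n)%N => kn; lia.
  move=> i _; rewrite /y exprMn -!exprM [((_ + j) * i)%N]mulnC mulnDr exprD.
  by ring.
apply: rpred_sum => i _; apply: rpredM.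
  apply/rpredX/Aint_pint/Aint_prim_root/x_prim.
apply: fP; rewrite exprMn zE -exprM mulnC exprM (prim_expr_order x_prim) expr1n.
by rewrite mul1r.
Qed.

(** Bezout gives i e = j n + 1, so x = z^i / p^j satisfies x^n = p a0^i. Each z^k is x^(e k) up to a
    power of a0, and e k runs through all residues modulo n: f(z) becomes a polynomial in x with
    permuted and rescaled coefficients. *)
Lemma pint_totally_ramified p n e (a a0 : int) (f : {poly rat}) (z : algC) :
  prime p -> (0 < n)%N -> (0 < e)%N -> coprime e n -> coprime `|a0| p ->
  a = p%:Z ^+ e * a0 -> (size f <= n)%N ->
  z ^+ n = a%:~R -> (ratr_poly f).[z] \in pint p ->
  forall m, ratr f`_m ^+ n * a%:~R ^+ m \in pint p.
Proof.
move=> p_pr n_gt0 e_gt0 en a0p aE sz_f zE fzS m.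
have [m_lt|m_ge] := ltnP m n; last first.
  by rewrite nth_default ?(leq_trans sz_f) // rmorph0 expr0n gtn_eqF // mul0r rpred0.
have pn0 : p%:R != 0 :> algC by rewrite pnatr_eq0 -lt0n prime_gt0.
have [i j ijE _] := egcdnP n e_gt0; rewrite (eqP en) in ijE.
have {}aE : a%:~R = p%:R ^+ e * a0%:~R :> algC by rewrite aE rmorphM rmorphXn.
set b : algC := a0%:~R in aE.
have bS : b \in pint p by apply/Aint_pint/Aint_int.
pose x := z ^+ i / p%:R ^+ j.
have pjn0 k : p%:R ^+ k != 0 :> algC by rewrite expf_neq0.
have xn : x ^+ n = p%:R * b ^+ i.
  rewrite expr_div_n -!exprM mulnC exprM zE aE exprMn -exprM [(e * i)%N]mulnC.
  by rewrite ijE addn1 exprS; field.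
have xS : x \in pint p.
  by apply: (@pint_expn_cancel _ _ n) => //; rewrite xn rpredM ?rpredX ?rpred_nat.
have zm k : z ^+ k * b ^+ (j * k) = x ^+ (e * k).
  have ik : (i * (e * k) = n * (j * k) + k)%N.
    by rewrite mulnA ijE mulnDl mul1n mulnA [(n * j)%N]mulnC.
  rewrite expr_div_n -!exprM ik (mulnCA j) exprD (exprM z) zE aE exprMn -!exprM.
  by field.
(* A factor a0^(j n) in front of f(z) keeps the exponents of a0 nonnegative: z^k absorbs a0^(j k),
   which leaves j (n - k), and x^n = p a0^i reduces e k modulo n. *)
pose c (k : 'I_n) : rat :=
  f`_k * p%:R ^+ (e * k %/ n) * a0%:~R ^+ (i * (e * k %/ n) + j * (n - k)).
pose g : {poly rat} := \sum_(k < n) c k *: 'X^(e * k %% n).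
have sz_g : (size g <= n)%N.
  apply: leq_trans (size_sum _ _ _) _; apply/bigmax_leqP => k _.
  apply: leq_trans (size_scale_leq _ _) _.
  by rewrite size_polyXn ltn_mod.
have gx : (ratr_poly g).[x] = b ^+ (j * n) * (ratr_poly f).[z].
  rewrite (horner_ratr f n) // big_distrr rmorph_sum horner_sum /=.
  apply: eq_bigr => k _; rewrite map_polyZ hornerZ map_polyXn hornerXn /c /=.
  rewrite !rmorphM !rmorphXn /= ratr_nat ratr_int -/b.
  have -> : (j * n = j * k + j * (n - k))%N by rewrite -mulnDr subnKC // ltnW.
  have xek : x ^+ (e * k) = (p%:R * b ^+ i) ^+ (e * k %/ n) * x ^+ (e * k %% n).
    by rewrite {1}(divn_eq (e * k) n) exprD mulnC exprM xn.
  rewrite !exprD [b ^+ (i * _)]exprM.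
  have := zm k; rewrite xek exprMn => zk.
  transitivity (ratr f`_k * (p%:R ^+ (e * k %/ n) * b ^+ i ^+ (e * k %/ n)
     * x ^+ (e * k %% n)) * b ^+ (j * (n - k))); first by ring.
  by rewrite -zk; ring.
have gS := eisenstein_rat p n x 0 0 (a0 ^+ i) g p_pr n_gt0 xS (rpred0 _) (rpred0 _).
have {gS} /(_ (e * m %% n)%N) : forall k, ratr g`_k \in pint p.
  apply: gS => //; first by rewrite abszX coprimeXl.
    by rewrite xn !mulr0 !addr0 rmorphXn.
  by rewrite gx rpredM ?rpredX.
have -> : g`_(e * m %% n) = c (Ordinal m_lt).
  rewrite coef_sum (bigD1 (Ordinal m_lt)) //= coefZ coefXn eqxx mulr1.
  rewrite big1 ?addr0 // => k; rewrite -val_eqE /= => km.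
  rewrite coefZ coefXn; case: eqP => [emk|]; last by rewrite mulr0.
  case/eqP: km; apply/eqP; rewrite -(modn_small (ltn_ord k)) -(modn_small m_lt).
  exact/eqP/(coprime_eqn_mod _ _ _ _ en (esym emk)).
rewrite /c /= !rmorphM !rmorphXn /= ratr_nat ratr_int -[a0%:~R ^+ _]rmorphXn mulrC.
move/pint_int_cancel; rewrite abszX coprimeXl // => /(_ isT).
set d := (e * m %/ n)%N => fdS.
have -> : ratr f`_m ^+ n * a%:~R ^+ m
    = (ratr f`_m * p%:R ^+ d) ^+ n * (p%:R ^+ (e * m %% n) * b ^+ m).
  rewrite aE !exprMn -!exprM {1}(divn_eq (e * m) n) exprD; ring.
apply: rpredM; first exact: rpredX.
by apply: rpredM; rewrite rpredX ?rpred_nat.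
Qed.

(** * The divisors [C_] and their power-free cofactors *)

Lemma pint_power_free_cancel q n (y : rat) (A : nat) : prime q ->
  (0 < A)%N -> (logn q A < n)%N -> ratr y ^+ n * A%:R \in pint q ->
  ratr y \in pint q.
Proof.
move=> q_pr A_gt0 An.
rewrite -rmorphXn -(ratr_nat algC) -rmorphM /= => /pint_ratP[N Nq /intrP[l lE]].
apply/pint_ratP; exists `|denq y|%N; last first.
  by rewrite -[_%:R]/((`|denq y|%N : int)%:~R) absz_denq mulrC -numqE intr_int.
rewrite prime_coprimeC //; apply/negP => qy.
have e : (N * (`|numq y| ^ n * A) = `|l| * `|denq y| ^ n)%N.
  have : N%:Z * (numq y ^+ n * A%:Z) = l * denq y ^+ n.
    apply: (@intr_inj rat); rewrite !intrM -lE !rmorphXn /= numqE exprMn.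
    by rewrite -[N%:~R]/(N%:R) -[A%:~R]/(A%:R); ring.
  by move/(congr1 absz); rewrite !abszM !abszX.
have : (q ^ n %| N * (`|numq y| ^ n * A))%N.
  by rewrite e dvdn_mull // dvdn_exp2r.
have qny : coprime q `|numq y|.
  by rewrite coprime_sym; apply: coprime_dvdr qy (coprime_num_den y).
rewrite Gauss_dvdr ?coprimeXl 1?coprime_sym // Gauss_dvdr; last first.
  by rewrite coprimeXl // coprimeXr.
by rewrite pfactor_dvdn // leqNgt An.
Qed.

Definition squarefree_coprime_family (n : nat) (aj : nat -> nat) : Prop :=
  [/\ forall j, (1 <= j < n)%N -> (0 < aj j)%N,
      forall j, (1 <= j < n)%N -> squarefree (aj j)
    & forall i j, (1 <= i < n)%N -> (1 <= j < n)%N -> i != j ->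
        coprime (aj i) (aj j)].

(** For |a| the product of the a_j^j and n = p^s, this is the n-th power free number |a|^m /
    C_m^n. *)
Definition C_cofactor (p s : nat) (aj : nat -> nat) (m : nat) : nat :=
  (\prod_(1 <= j < p ^ s) aj j ^ (j * m %% p ^ s))%N.

Lemma prod_family_gt0 n aj (e : nat -> nat) : squarefree_coprime_family n aj ->
  (0 < \prod_(1 <= j < n) aj j ^ e j)%N.
Proof.
case=> aj_gt0 _ _; rewrite big_seq; elim/big_ind: _ => // [x y|j].
  by rewrite muln_gt0 => -> ->.
by rewrite mem_index_iota expn_gt0 => /aj_gt0 ->.
Qed.

Lemma expn_absz_C p s aj m :
  ((\prod_(1 <= j < p ^ s) aj j ^ j) ^ m
   = C_cofactor p s aj m * C_ p s aj m ^ (p ^ s))%N.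
Proof.
have exp_prod k (F : nat -> nat) :
    ((\prod_(1 <= j < p ^ s) F j) ^ k = \prod_(1 <= j < p ^ s) F j ^ k)%N.
  by apply: (big_morph (expn^~ k)) => [x y|]; rewrite ?expnMn ?exp1n.
rewrite /C_cofactor /C_ !exp_prod -big_split; apply: eq_bigr => j _ /=.
by rewrite -!expnM -expnD addnC -divn_eq.
Qed.

(** By coprimality q divides at most one a_j, and only once, so the exponent is 0 or the remainder
    of j m modulo p^s. *)
Lemma logn_C_cofactor p s aj q m : prime q -> (0 < p ^ s)%N ->
  squarefree_coprime_family (p ^ s) aj -> (logn q (C_cofactor p s aj m) < p ^ s)%N.
Proof.
move=> q_pr n_gt0 ajP; have [aj_gt0 aj_sqf aj_cop] := ajP; rewrite /C_cofactor.
have cop_prod (P : pred nat) :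
    (forall j, (1 <= j < p ^ s)%N -> P j -> coprime q (aj j)) ->
    coprime q (\prod_(1 <= j < p ^ s | P j) aj j ^ (j * m %% p ^ s)).
  move=> jP; rewrite big_seq_cond; elim/big_ind: _ => // [|x y|j].
  - exact: coprimen1.
  - by rewrite coprimeMr => -> ->.
  - by rewrite mem_index_iota => /andP[jn Pj]; rewrite coprimeXr // jP.
have [/hasP[i]|/hasPn jq] := boolP (has (fun j => q %| aj j)%N (index_iota 1 (p ^ s))).
  rewrite mem_index_iota => i_n qi.
  rewrite (bigD1_seq i) ?mem_index_iota ?iota_uniq //=.
  rewrite mulnC logn_Gauss; last first.
    apply: cop_prod => j jn ji; apply: coprime_dvdl qi _.
    by apply: aj_cop; rewrite // eq_sym.
  rewrite lognX (@leq_ltn_trans (i * m %% p ^ s)) ?ltn_mod //.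
  rewrite -{2}[(_ %% _)%N]muln1 leq_mul2l -ltnS ltnNge; apply/orP; right.
  by rewrite -pfactor_dvdn ?aj_gt0 // aj_sqf.
rewrite logn_coprime //; apply: cop_prod => j jn _.
by rewrite prime_coprime // jq // mem_index_iota.
Qed.

Lemma pint_mul_C p s (a : int) aj q m (c : rat) : prime q -> (0 < p ^ s)%N ->
  `|a|%N = (\prod_(1 <= j < p ^ s) aj j ^ j)%N ->
  squarefree_coprime_family (p ^ s) aj ->
  ratr c ^+ (p ^ s) * a%:~R ^+ m \in pint q ->
  ratr (c * (C_ p s aj m)%:R) \in pint q.
Proof.
move=> q_pr n_gt0 aE ajP cS.
apply: (pint_power_free_cancel q (p ^ s) _ (C_cofactor p s aj m)) => //.
- exact: prod_family_gt0.
- exact: logn_C_cofactor.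
have aC : `|a|%N%:R ^+ m
    = (C_cofactor p s aj m)%:R * (C_ p s aj m)%:R ^+ (p ^ s) :> algC.
  by rewrite -!natrX -natrM aE expn_absz_C.
have aS : a%:~R ^+ m = (-1) ^+ ((a < 0)%R * m) * `|a|%N%:R ^+ m :> algC.
  by rewrite {1}[a]intEsign intrM rmorphXn rmorphN1 exprMn -exprM.
move: cS; rewrite aS mulrCA rpredMsign aC rmorphM /= ratr_nat.
by move: (ratr c) => x; rewrite (exprMn _ x) mulrA mulrAC.
Qed.

(** The local bounds collected. [C_] handles the primes other than p, and also p if it divides a,
    since v_p(a) is then prime to p; otherwise the bound at p comes from p^k. *)
Lemma lead_coef_int p s (a : int) aj k (f : {poly rat}) : prime p -> (0 < s)%N ->
  `|a|%N = (\prod_(1 <= j < p ^ s) aj j ^ j)%N ->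
  squarefree_coprime_family (p ^ s) aj ->
  ~~ (p %| gcdn `|a| (vp p a))%N ->
  (p %| `|a|)%N \/ (exists2 D,
     (s <= D)%N || ~~ (p%:Z ^+ D.+2 %| a ^+ p.-1 - 1)%Z &
     (D <= k)%N || (size f <= p ^ s - p ^ (s - k.+1))%N) ->
  (size f <= p ^ s)%N ->
  (forall z : algC, z ^+ (p ^ s) = a%:~R -> (ratr_poly f).[z] \in Aint) ->
  lead_coef f * (p ^ k * C_ p s aj (size f).-1)%:R \in Num.int.
Proof.
move=> p_pr s_gt0 aE ajP p_ndvd kP sz_f fA; apply: pint_rat_int => q q_pr.
have n_gt0 : (0 < p ^ s)%N by rewrite expn_gt0 prime_gt0.
have fP z : z ^+ (p ^ s) = a%:~R -> (ratr_poly f).[z] \in pint q.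
  by move/fA/Aint_pint.
have a_gt0 : (0 < `|a|)%N by rewrite aE prod_family_gt0.
have homog : (forall m, ratr f`_m ^+ (p ^ s) * a%:~R ^+ m \in pint q) ->
    ratr (lead_coef f * (p ^ k * C_ p s aj (size f).-1)%:R) \in pint q.
  move=> hS; rewrite natrM mulrCA rmorphM /= ratr_nat rpredM ?rpred_nat //.
  by rewrite lead_coefE; apply: (pint_mul_C p s a).
have [qp|pq] := eqVneq q p; last first.
  apply/homog/pint_homogeneous => //.
  by rewrite coprimeXl // prime_coprime // dvdn_prime2 // eq_sym.
subst q; have [pa|pa] := boolP (p %| `|a|)%N.
  have e_gt0 : (0 < logn p `|a|)%N by rewrite logn_gt0 mem_primes p_pr a_gt0.
  have [b pb bE] := pfactor_coprime p_pr a_gt0.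
  have zE := rootCK n_gt0 (a%:~R : algC).
  apply/homog/(pint_totally_ramified p _ (logn p `|a|) a ((-1) ^+ (a < 0)%R * b%:Z)
    _ _ p_pr n_gt0 e_gt0 _ _ _ sz_f zE (fP _ zE)).
  - rewrite coprimeXr // coprime_sym prime_coprime //.
    by apply: contra p_ndvd => pe; rewrite dvdn_gcd pa.
  - by rewrite abszMsign coprime_sym.
  - by rewrite {1}[a]intEsign {1}bE PoszM PoszX; ring.
case: kP => [|[D aD fk]]; first by rewrite (negPf pa).
have pS : p%:R ^+ k * ratr (lead_coef f) \in pint p.
  by apply: (pint_lead_coef_pure p s D k a) => //; rewrite prime_coprimeC.
rewrite natrM natrX mulrA [lead_coef f * _]mulrC !rmorphM rmorphXn /= !ratr_nat.
by rewrite rpredM ?rpred_nat.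
Qed.

(** * Integral bases of pure fields *)

(** From (i+1) C(p^k, i+1) = p^k C(p^k - 1, i): the binomial coefficient lacks at most v_p(i+1)
    factors p, and v_p(i+1) <= i. *)
Lemma dvdn_pexp_bin p k i : prime p -> (i < p ^ k)%N ->
  (p ^ k %| 'C(p ^ k, i.+1) * p ^ i)%N.
Proof.
move=> p_pr ik; have bin_pos : (0 < 'C(p ^ k, i.+1))%N by rewrite bin_gt0.
have pi_gt0 : (0 < p ^ i)%N by rewrite expn_gt0 prime_gt0.
rewrite pfactor_dvdn ?muln_gt0 ?bin_pos // lognM // (pfactorK i p_pr).
have : (k <= logn p (i.+1 * 'C(p ^ k, i.+1)))%N.
  by rewrite -pfactor_dvdn ?muln_gt0 ?bin_pos // -mul_bin_diag dvdn_mulr.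
rewrite lognM // => /leq_trans; apply; rewrite addnC leq_add2l -ltnS.
rewrite (leq_trans (ltn_expl _ (prime_gt1 p_pr))) //.
by rewrite dvdn_leq // pfactor_dvdnn.
Qed.

Section NumberField.

Context {K : fieldExtType rat} (theta : K).

Local Notation evalK f := ((map_poly (in_alg K) f).[theta]).

Lemma natK_eq0 n : (n%:R == 0 :> K) = (n == 0%N).
Proof. by rewrite -(rmorph_nat (in_alg K)) fmorph_eq0 pnatr_eq0. Qed.

Lemma intK_eq0 (c : int) : (c%:~R == 0 :> K) = (c == 0).
Proof. by rewrite -(rmorph_int (in_alg K)) fmorph_eq0 intr_eq0. Qed.

Lemma irreducible_dvdp_root (G F : {poly rat}) : irreducible_poly G ->
  root (map_poly (in_alg K) G) theta -> evalK F = 0 -> G %| F.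
Proof.
move=> G_irr Gt F0; apply: contraT; rewrite -irreducible_poly_coprime //.
rewrite -(coprimep_map (in_alg K)) => /coprimep_root/(_ Gt).
by rewrite F0 eqxx.
Qed.

(** A monic integer equation r of f(theta) means that G divides the composite of r and f, so it
    passes to every root of G in [algC]. *)
Lemma algebraic_integer_conj (G f : {poly rat}) (z : algC) :
  irreducible_poly G -> root (map_poly (in_alg K) G) theta ->
  root (ratr_poly G) z -> algebraic_integer (evalK f) ->
  (ratr_poly f).[z] \in Aint.
Proof.
move=> G_irr Gt Gz [r r_mon rx].
have mapK : map_poly (in_alg K) (map_poly intr r) = map_poly intr r.
  by rewrite -map_poly_comp; apply: eq_map_poly => i /=; rewrite scaler_int.
have mapC : ratr_poly (map_poly intr r) = map_poly intr r.
  by rewrite -map_poly_comp; apply: eq_map_poly => i /=; rewrite ratr_int.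
have /dvdpP[Q QE] : G %| map_poly intr r \Po f.
  apply: irreducible_dvdp_root => //.
  by rewrite map_comp_poly mapK horner_comp; exact/rootP.
apply/Aint_integralP; exists r => //; apply/rootP.
rewrite -mapC -horner_comp -map_comp_poly QE rmorphM /= hornerM (rootP Gz).
by rewrite mulr0.
Qed.

(** Spanning: by the last hypothesis an integer multiple of one [B m] cancels the leading term, and
    the degree drops. Independence: the coefficients vanish from the top degree down. *)
Lemma integral_basis_triangular n (B : nat -> {poly rat}) :
  (forall m, (m < n)%N -> size (B m) = m.+1) ->
  (forall m, (m < n)%N -> algebraic_integer (evalK (B m))) ->
  (forall x : K, exists2 f : {poly rat}, (size f <= n)%N & x = evalK f) ->
  (forall f : {poly rat}, (size f <= n)%N -> evalK f = 0 -> f = 0) ->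
  (forall f : {poly rat}, f != 0 -> (size f <= n)%N -> algebraic_integer (evalK f) ->
     lead_coef f / lead_coef (B (size f).-1) \in Num.int) ->
  integral_basis (fun m : 'I_n => evalK (B m)).
Proof.
move=> sz_B B_int span free lead_int; split=> [i|x|c].
- exact: B_int.
- have [f sz_f ->] := span x.
  have [N] := ubnPleq (size f); elim: N f sz_f => [|N IHN] f sz_f fN f_int.
    exists (fun=> 0); rewrite big1 => [|i _]; last by rewrite mul0r.
    by move: fN; rewrite leqn0 size_poly_eq0 => /eqP ->; rewrite rmorph0 horner0.
  have [->|f_neq0] := eqVneq f 0.
    exists (fun=> 0); rewrite big1 => [|i _]; last by rewrite mul0r.
    by rewrite rmorph0 horner0.
  have /intrP[c0 c0E] := lead_int f f_neq0 sz_f f_int.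
  have f_gt0 : (0 < size f)%N by rewrite size_poly_gt0.
  set m := (size f).-1 in c0E.
  have sz_m : size f = m.+1 by rewrite prednK.
  have mn : (m < n)%N by rewrite -sz_m.
  pose g := f - c0%:~R *: B m.
  have gK : evalK g = evalK f - c0%:~R * evalK (B m).
    by rewrite rmorphB /= hornerD hornerN map_polyZ hornerZ /= scaler_int.
  have lB : lead_coef (B m) != 0 by rewrite lead_coef_eq0 -size_poly_eq0 sz_B.
  have sz_g : (size g <= m)%N.
    apply/leq_sizeP => j; rewrite leq_eqVlt => /predU1P[<-|mj].
      rewrite coefB coefZ -c0E -[f`_m]/(f`_(size f).-1) -lead_coefE.
      have -> : (B m)`_m = lead_coef (B m) by rewrite lead_coefE sz_B.
      by rewrite mulfVK // subrr.
    by rewrite coefB coefZ !nth_default ?mulr0 ?subrr // ?sz_B ?sz_m.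
  have [|||c cE] := IHN g.
  - by rewrite (leq_trans sz_g) // ltnW.
  - by rewrite (leq_trans sz_g) // -ltnS -sz_m.
  - rewrite gK; apply: integral_sub => //; apply: integral_mul (B_int _ mn).
    exact: integral_id.
  exists (fun i => c i + (c0 *+ (i == m :> nat))).
  rewrite -[LHS](subrK (c0%:~R * evalK (B m))) -gK cE.
  under [RHS]eq_bigr do rewrite intrD mulrDl.
  rewrite big_split /=; congr (_ + _).
  rewrite (bigD1 (Ordinal mn)) //= eqxx big1 ?addr0 // => i.
  by rewrite -val_eqE /= => /negPf ->; rewrite mul0r.
- move=> c0; have f0 : \sum_(i < n) (c i)%:~R *: B i = 0.
    apply: free.
      apply: leq_trans (size_sum _ _ _) _; apply/bigmax_leqP => i _.
      by apply: leq_trans (size_scale_leq _ _) _; rewrite sz_B.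
    rewrite rmorph_sum horner_sum -[RHS]c0; apply: eq_bigr => i _.
    by rewrite /= map_polyZ hornerZ /= scaler_int.
  move=> i; have [N] := ubnP (n - i); elim: N i => // N IHN i iN.
  have := congr1 (fun g : {poly rat} => g`_i) f0; rewrite coef0 coef_sum.
  rewrite (bigD1 i) //= big1 => [|j ji]; last first.
    have [lt_ij|le_ji] := ltnP i j.
      rewrite IHN ?scale0r ?coef0 //.
      by have := ltn_ord j; move: iN; rewrite /=; lia.
    rewrite coefZ [(B j)`_i]nth_default ?mulr0 // sz_B //.
    by rewrite ltn_neqAle le_ji andbT.
  rewrite addr0 coefZ => /eqP; rewrite mulf_eq0 intr_eq0.
  have -> : (B i)`_i = lead_coef (B i) by rewrite lead_coefE sz_B.
  by rewrite lead_coef_eq0 -size_poly_eq0 sz_B //= orbF => /eqP.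
Qed.

Lemma integral_expn n (x : K) : (0 < n)%N ->
  algebraic_integer (x ^+ n) -> algebraic_integer x.
Proof.
move=> n_gt0 xn; apply: (integral_root_monic (p := 'X^n - (x ^+ n)%:P)).
- exact: monicXnsubC.
- by apply/rootP; rewrite hornerD hornerN hornerXn hornerC subrr.
- apply: (integral_poly _ _).1 => i; rewrite coefB coefXn coefC.
  apply: integral_sub; first exact: integral_nat.
  by case: (i == 0%N); [exact: xn | exact: integral0].
Qed.

(* [y = (\sum_(i < n) u ^+ i) / n] satisfies [u y = y + c] with [c = (b - 1) / n],
   hence [(y + c) ^+ n = b y ^+ n]; dividing by [b - 1 = n c] gives a monic
   equation. *)
Lemma integral_geometric_mean p k (u : K) (b : int) : prime p ->
  u ^+ (p ^ k) = b%:~R -> (p%:Z ^+ k.+1 %| b - 1)%Z ->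
  algebraic_integer ((\sum_(i < p ^ k) u ^+ i) / (p ^ k)%:R).
Proof.
move=> p_pr uE /dvdzP[c' c'E]; set n := (p ^ k)%N in uE *; set y := _ / _.
have n_gt0 : (0 < n)%N by rewrite expn_gt0 prime_gt0.
have nK0 : n%:R != 0 :> K by rewrite natK_eq0 -lt0n.
have uS : (u - 1) * (\sum_(i < n) u ^+ i) = b%:~R - 1 by rewrite -subrX1 uE.
(* Here c = 0 excludes the division by n c, but y is then 1 or 0. *)
have [b1|b_neq1] := eqVneq b 1.
  rewrite b1 subrr in uS; move/eqP: uS; rewrite mulf_eq0 subr_eq0.
  case/orP=> /eqP e; last by rewrite /y e mul0r; exact: integral0.
  rewrite /y e (eq_bigr (fun=> 1)) => [|i _]; last by rewrite expr1n.
  by rewrite sumr_const card_ord divff //; exact: integral1.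
have [c cE] : exists c, c = c' * p%:Z by eexists.
have bE : b - 1 = c * n%:Z by rewrite c'E exprS cE PoszX; ring.
have c_neq0 : c != 0.
  by apply: contra_neq b_neq1 => c0; apply/eqP; rewrite -subr_eq0 bE c0 mul0r.
have uy : u * y = y + c%:~R.
  have : (u - 1) * y = c%:~R.
    rewrite mulrA uS -[1]/(1%:~R) -intrB bE intrM mulfK //.
  by rewrite mulrBl mul1r => <-; rewrite addrC subrK.
(* c is a multiple of p because the hypothesis has p^(k+1) rather than p^k; this makes every C(n,
   i+1) c^i divisible by n. *)
have /fin_all_exists[d dE] (i : 'I_n) :
    exists d : int, ('C(n, i.+1))%:Z * c ^+ i = n%:Z * d.
  have /dvdnP[d dE] := dvdn_pexp_bin p k i p_pr (ltn_ord i).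
  by exists (d%:Z * c' ^+ i); rewrite cE exprMn mulrCA -PoszX -PoszM dE PoszM; ring.
exists ('X^n - \sum_(i < n) d i *: 'X^(n.-1 - i)).
  rewrite monicE lead_coefDl ?lead_coefXn // size_polyN size_polyXn ltnS.
  apply: leq_trans (size_sum _ _ _) _; apply/bigmax_leqP => i _.
  apply: leq_trans (size_scale_leq _ _) _; rewrite size_polyXn.
  by have := ltn_ord i; lia.
apply/rootP; rewrite rmorphB /= map_polyXn hornerD hornerN hornerXn.
apply/eqP; rewrite subr_eq0; apply/eqP.
have ncK0 : n%:R * c%:~R != 0 :> K by rewrite mulf_neq0 // intK_eq0.
apply: (mulfI ncK0).
have -> : n%:R * c%:~R * y ^+ n = (b%:~R - 1) * y ^+ n.
  by rewrite -[1 in RHS]/(1%:~R) -intrB bE intrM mulrC [in RHS]mulrC [n%:R * _]mulrC.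
rewrite mulrBl mul1r -uE -exprMn uy exprDn big_ord_recl /= subn0 bin0 mulr1n.
rewrite expr0 mulr1 addrC addKr rmorph_sum horner_sum big_distrr /=.
apply: eq_bigr => i _; rewrite /bump /= add1n map_polyZ hornerZ map_polyXn hornerXn.
have /(congr1 (intr : int -> K)) := dE i; rewrite !intrM rmorphXn /= => dE'.
rewrite -[(Posz n)%:~R]/(n%:R) in dE'.
have -> : n%:R * c%:~R * ((d i)%:~R * y ^+ (n.-1 - i))
   = c%:~R * (n%:R * (d i)%:~R) * y ^+ (n.-1 - i) by ring.
rewrite -dE' -[(Posz _)%:~R]/(('C(n, i.+1))%:R) -mulr_natl exprS.
rewrite subnS -subn1 subnAC subn1.
by ring.
Qed.

End NumberField.

(** Serves both bases, with [k] constantly 0 for the first. The last hypothesis makes the leading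
    coefficients of [B] attain the bound of [lead_coef_int]. *)
Lemma integral_basis_pure p s (a : int) aj (K : fieldExtType rat) (theta : K)
    (k : nat -> nat) (B : nat -> {poly rat}) :
  prime p -> (0 < s)%N ->
  irreducible_poly ('X^(p ^ s) - (a%:~R)%:P : {poly rat}) ->
  `|a|%N = (\prod_(1 <= j < p ^ s) aj j ^ j)%N ->
  squarefree_coprime_family (p ^ s) aj ->
  ~~ (p %| gcdn `|a| (vp p a))%N ->
  theta ^+ (p ^ s) = a%:~R -> <<1; theta>>%VS = fullv ->
  (forall m, (m < p ^ s)%N -> size (B m) = m.+1) ->
  (forall m, (m < p ^ s)%N -> lead_coef (B m) = ((p ^ k m * C_ p s aj m)%:R)^-1) ->
  (forall m, (m < p ^ s)%N -> algebraic_integer (map_poly (in_alg K) (B m)).[theta]) ->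
  (p %| `|a|)%N \/ (exists2 D,
     (s <= D)%N || ~~ (p%:Z ^+ D.+2 %| a ^+ p.-1 - 1)%Z &
     forall m, (m < p ^ s)%N ->
       (D <= k m)%N || (m < p ^ s - p ^ (s - (k m).+1))%N) ->
  integral_basis (fun m : 'I_(p ^ s) => (map_poly (in_alg K) (B m)).[theta]).
Proof.
move=> p_pr s_gt0; set n := (p ^ s)%N; set G : {poly rat} := 'X^n - _.
move=> G_irr aE ajP p_ndvd thetaE K_gen sz_B lead_B B_int kP.
have n_gt0 : (0 < n)%N by rewrite expn_gt0 prime_gt0.
have sz_G : size G = n.+1 by rewrite size_XnsubC.
have G_neq0 : G != 0 by rewrite -size_poly_eq0 sz_G.
have Gt : root (map_poly (in_alg K) G) theta.
  apply/rootP; rewrite rmorphB /= map_polyXn map_polyC /= scaler_int.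
  by rewrite hornerD hornerN hornerXn hornerC thetaE subrr.
apply: integral_basis_triangular => // [x|f sz_f f0|f f_neq0 sz_f f_int].
- have : x \in <<1; theta>>%VS by rewrite K_gen memvf.
  case/Fadjoin_polyP=> g /polyOver1P[q ->] ->; exists (q %% G).
    by rewrite -ltnS -sz_G ltn_modp.
  rewrite {1}(divp_eq q G) rmorphD rmorphM /= hornerD hornerM (rootP Gt).
  by rewrite mulr0 add0r.
- apply/eqP; apply: contraT => f_neq0.
  have /dvdp_leq := irreducible_dvdp_root theta G f G_irr Gt f0.
  by move/(_ f_neq0); rewrite sz_G ltnNge sz_f.
have sz_pos : (0 < size f)%N by rewrite size_poly_gt0.
have mn : ((size f).-1 < n)%N by rewrite prednK.
rewrite lead_B // invrK; apply: (lead_coef_int p s a) => //.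
  case: kP => [|[D aD kP]]; [by left | right; exists D => //].
  by have := kP _ mn; rewrite prednK.
move=> z zE; apply: (algebraic_integer_conj theta G) => //.
apply/rootP; rewrite rmorphB /= map_polyXn map_polyC /= ratr_int.
by rewrite hornerD hornerN hornerXn hornerC zE subrr.
Qed.

(** * Integrality of the candidate basis elements *)

Lemma algebraic_integer_div_C p s (a : int) aj (K : fieldExtType rat) (theta : K) m :
  (0 < p ^ s)%N ->
  `|a|%N = (\prod_(1 <= j < p ^ s) aj j ^ j)%N ->
  squarefree_coprime_family (p ^ s) aj ->
  theta ^+ (p ^ s) = a%:~R ->
  algebraic_integer (theta ^+ m / (C_ p s aj m)%:R).
Proof.
move=> n_gt0 aE ajP thetaE; apply: (integral_expn _ _ n_gt0).
have C_neq0 : (C_ p s aj m)%:R != 0 :> K.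
  by rewrite natK_eq0 -lt0n prod_family_gt0.
have -> : (theta ^+ m / (C_ p s aj m)%:R) ^+ (p ^ s)
    = ((-1) ^+ ((a < 0)%R * m) * (C_cofactor p s aj m)%:Z)%:~R.
  rewrite expr_div_n -exprM mulnC exprM thetaE {1}[a]intEsign.
  rewrite !intrM !rmorphXn rmorphN1 /= exprMn -exprM -[(Posz _)%:~R]/(`|a|%N%:R).
  rewrite -natrX aE expn_absz_C natrM natrX mulrA mulfK ?expf_neq0 //.
exact: integral_id.
Qed.

Lemma totient_prime_pow p s : prime p -> (0 < s)%N ->
  totient (p ^ s) = (p ^ s - p ^ s.-1)%N.
Proof.
move=> p_pr s_gt0; rewrite totient_pfactor // -{2}(prednK s_gt0) expnS.
by rewrite -subn1 mulnBl mul1n.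
Qed.

(* [(p - 2) p ^ t + 1] is a multiple of [p - 1]. *)
Lemma dvdz_root_of_unity_approx p k t E (a a' : int) : prime p ->
  (E * p ^ k = (p - 2) * p ^ t)%N ->
  (p%:Z ^+ k.+1 %| a ^+ p.-1 - 1)%Z ->
  (p%:Z ^+ k.+1 %| a' - a ^+ E)%Z ->
  (p%:Z ^+ k.+1 %| a' ^+ (p ^ k) * a - 1)%Z.
Proof.
move=> p_pr Et a1 a'E; have p_gt1 := prime_gt1 p_pr.
have [q qE] : exists q, ((p - 2) * p ^ t + 1 = p.-1 * q)%N.
  have /dvdnP[l lE] := dvdn_pred_predX p t.
  have pt_gt0 : (0 < p ^ t)%N by rewrite expn_gt0 prime_gt0.
  exists (p ^ t - l)%N; rewrite mulnBr [(p.-1 * l)%N]mulnC -lE.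
  have -> : p.-1 = (p - 2).+1 by lia.
  by rewrite mulSn; move: (_ * _)%N => x; lia.
rewrite -(subrKA (a ^+ E ^+ (p ^ k) * a)) rpredD //.
  by rewrite -mulrBl dvdz_mulr // dvdz_subXX.
rewrite -exprM Et -exprSr -addn1 qE exprM -[X in _ - X](expr1n _ q).
exact: dvdz_subXX.
Qed.

(** The element is e theta^j times the mean of the powers of u = b theta^(p^(s-k)), minus h theta^m
    / C, where e C b^(p^k - 1) = 1 + h p^k. The top power of u, absent from the displayed sum,
    produces theta^m. *)
Lemma algebraic_integer_block p s k j m C (a b e : int) (K : fieldExtType rat)
    (theta : K) :
  prime p -> (k <= s)%N -> theta ^+ (p ^ s) = a%:~R ->
  (p%:Z ^+ k.+1 %| b ^+ (p ^ k) * a - 1)%Z ->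
  (p%:Z ^+ k %| e * C%:Z * b ^+ (p ^ k).-1 - 1)%Z ->
  (j + p ^ (s - k) * (p ^ k).-1)%N = m -> (0 < C)%N ->
  algebraic_integer theta -> algebraic_integer (theta ^+ m / C%:R) ->
  algebraic_integer ((theta ^+ m + e%:~R * C%:R * theta ^+ j *
    \sum_(0 <= i < (p ^ k).-1) (b%:~R * theta ^+ (p ^ (s - k))) ^+ i)
    / (p ^ k * C)%:R).
Proof.
move=> p_pr ks thetaE b1 /dvdzP[h hE] jE C_gt0 theta_int thetaC.
set u := b%:~R * _; have pk_gt0 : (0 < p ^ k)%N by rewrite expn_gt0 prime_gt0.
have uE : u ^+ (p ^ k) = (b ^+ (p ^ k) * a)%:~R.
  by rewrite exprMn -exprM -expnD subnK // thetaE intrM rmorphXn.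
have y_int := integral_geometric_mean p k u _ p_pr uE b1.
have sumE : \sum_(i < p ^ k) u ^+ i
    = \sum_(0 <= i < (p ^ k).-1) u ^+ i + u ^+ (p ^ k).-1.
  by rewrite -(big_mkord xpredT (fun i => u ^+ i)) -{1}(prednK pk_gt0) big_nat_recr.
have ujE : theta ^+ j * u ^+ (p ^ k).-1 = b%:~R ^+ (p ^ k).-1 * theta ^+ m.
  by rewrite exprMn -exprM mulrCA -exprD jE.
have pkK : (p ^ k)%:R != 0 :> K by rewrite natK_eq0 -lt0n.
have CK : C%:R != 0 :> K by rewrite natK_eq0 -lt0n.
have hE' : e%:~R * C%:R * b%:~R ^+ (p ^ k).-1 = 1 + h%:~R * (p ^ k)%:R :> K.
  have /(congr1 (intr : int -> K)) : e * C%:Z * b ^+ (p ^ k).-1 = 1 + h * (p ^ k)%N%:Z.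
    by rewrite PoszX -hE addrC subrK.
  by rewrite intrD !intrM rmorphXn.
rewrite [X in algebraic_integer X](_ : _ = e%:~R * theta ^+ j
    * ((\sum_(i < p ^ k) u ^+ i) / (p ^ k)%:R) + (- h)%:~R * (theta ^+ m / C%:R)).
  apply: integral_add; apply: integral_mul => //; try exact: integral_id.
  apply: integral_mul; first exact: integral_id.
  elim: (j) => [|i IHi]; first by rewrite expr0; exact: integral1.
  by rewrite exprS; exact: integral_mul.
rewrite sumE natrM; set S := \sum_(_ <= _ < _) _.
have -> : e%:~R * theta ^+ j * ((S + u ^+ (p ^ k).-1) / (p ^ k)%:R)
  = e%:~R * theta ^+ j * S / (p ^ k)%:R
    + e%:~R * (theta ^+ j * u ^+ (p ^ k).-1) / (p ^ k)%:R by ring.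
have -> : e%:~R * (theta ^+ j * u ^+ (p ^ k).-1) / (p ^ k)%:R
   = (1 + h%:~R * (p ^ k)%:R) * theta ^+ m / ((p ^ k)%:R * C%:R).
  by rewrite -hE' ujE; field; rewrite pkK CK.
by rewrite rmorphN /=; field; rewrite pkK CK.
Qed.

Theorem theorem1p3 (p s : nat) (a : int) (aj : nat -> nat)
    (K : fieldExtType rat) (theta : K)
    (p_prime : prime p) (s_ge1 : (1 <= s)%N)
    (irr : irreducible_poly ('X^(p ^ s) - (a%:~R)%:P : {poly rat}))
    (a_free : power_free (p ^ s) `|a|%N)
    (aj_prod : `|a|%N = (\prod_(1 <= j < p ^ s) aj j ^ j)%N)
    (aj_gt0 : forall j, (1 <= j < p ^ s)%N -> (0 < aj j)%N)
    (aj_sqf : forall j, (1 <= j < p ^ s)%N -> squarefree (aj j))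
    (aj_cop : forall i j, (1 <= i < p ^ s)%N -> (1 <= j < p ^ s)%N ->
       i != j -> coprime (aj i) (aj j))
    (p_ndvd : ~~ (p %| gcdn `|a| (vp p a))%N)
    (theta_root : root ('X^(p ^ s) - (a%:~R)%:P) theta)
    (K_gen : <<1; theta>>%VS = fullv) :
  (r_ p a = 0 \/ r_ p a = -1 ->
     integral_basis
       (fun m : 'I_(p ^ s) => theta ^+ m / (C_ p s aj m)%:R))
  /\
  (1 <= r_ p a ->
   forall a' w : nat -> int,
     (forall m : nat, (totient (p ^ s) <= m < p ^ s)%N ->
        let k := k_ p s a m in
        ((k < s)%N ->
           (a' m = a ^+ ((p - 2) * p ^ (s - k - 1))%N
              %[mod (p ^ k.+1)%N%:Z])%Z)
        /\ (k = s -> (a' m = a ^+ (p - 2)%N %[mod (p ^ k.+1)%N%:Z])%Z)) ->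
     (forall m : nat, (totient (p ^ s) <= m < p ^ s)%N ->
        let k := k_ p s a m in
        (w m * (C_ p s aj m)%:Z * a' m ^+ (p ^ k - 1)%N = 1
           %[mod (p ^ k)%N%:Z])%Z) ->
     integral_basis
       (fun m : 'I_(p ^ s) =>
          if (m < totient (p ^ s))%N then theta ^+ m / (C_ p s aj m)%:R
          else (theta ^+ m + delta p s a aj a' w K theta m)
                 / (p ^ k_ p s a m * C_ p s aj m)%:R)).
Proof.
have n_gt0 : (0 < p ^ s)%N by rewrite expn_gt0 prime_gt0.
have p_gt1 := prime_gt1 p_prime.
have ajP : squarefree_coprime_family (p ^ s) aj by [].
have thetaE : theta ^+ (p ^ s) = a%:~R.
  move/rootP: theta_root; rewrite hornerD hornerN hornerXn hornerC => /eqP.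
  by rewrite subr_eq0 => /eqP.
have a_gt0 : (0 < `|a|)%N by rewrite aj_prod prod_family_gt0.
have C_neq0 m : (C_ p s aj m)%:R != 0 :> rat.
  by rewrite pnatr_eq0 -lt0n prod_family_gt0.
have thetaC m := algebraic_integer_div_C p s a aj K theta m n_gt0 aj_prod ajP thetaE.
pose B0 m : {poly rat} := (C_ p s aj m)%:R^-1 *: 'X^m.
have B0_sz m : size (B0 m) = m.+1 by rewrite size_scale ?invr_eq0 // size_polyXn.
have B0_lead m : lead_coef (B0 m) = (C_ p s aj m)%:R^-1.
  by rewrite lead_coefZ lead_coefXn mulr1.
have B0_eval m : (map_poly (in_alg K) (B0 m)).[theta] = theta ^+ m / (C_ p s aj m)%:R.
  rewrite map_polyZ hornerZ map_polyXn hornerXn mulrC; congr (_ * _).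
  by rewrite fmorphV rmorph_nat.
(* At 0 [vp] would take its default value 0. If a^(p-1) = 1, then a^(p^s) = a and the irreducible
   polynomial, of degree above 1, has the rational root a. *)
have a1_neq0 : a ^+ p.-1 - 1 != 0.
  apply/negP; rewrite subr_eq0 => /eqP a1.
  have ap : a ^+ p = a by rewrite -(prednK (prime_gt0 p_prime)) exprS a1 mulr1.
  have an t : a ^+ (p ^ t) = a by elim: t => // t IHt; rewrite expnS exprM ap.
  have : root ('X^(p ^ s) - (a%:~R)%:P : {poly rat}) a%:~R.
    by apply/rootP; rewrite hornerD hornerN hornerXn hornerC -rmorphXn /= an subrr.
  rewrite -dvdp_XsubCl => /(apply_irredp irr); rewrite size_XsubC => /(_ isT).
  move/eqp_size; rewrite size_XsubC size_XnsubC // => -[] n1.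
  by have := ltn_expl s p_gt1; rewrite -n1; case: (s) s_ge1.
have vp_dvd i : (p%:Z ^+ i %| a ^+ p.-1 - 1)%Z = (i <= vp p (a ^+ p.-1 - 1))%N.
  by rewrite dvdzE abszX pfactor_dvdn // absz_gt0.
split=> [r0|r_ge1 a' w a'P wP].
- have -> : (fun m : 'I_(p ^ s) => theta ^+ m / (C_ p s aj m)%:R)
      = (fun m : 'I_(p ^ s) => (map_poly (in_alg K) (B0 m)).[theta]).
    by apply/funext => m; rewrite B0_eval.
  apply: (integral_basis_pure p s a aj K theta (fun=> 0%N)) => //.
  + by move=> m _; rewrite B0_lead mul1n.
  + by move=> m _; rewrite B0_eval.
  (* D = 0 is allowed because r <= 0 means that p^2 does not divide a^(p-1) - 1. *)
  have [pa|pa] := boolP (p %| `|a|)%N; [by left | right; exists 0%N => //].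
  have vp_gt0 : (1 <= vp p (a ^+ p.-1 - 1))%N.
    by rewrite -vp_dvd; apply: dvdz_fermat_sub1; rewrite ?prime_coprimeC.
  rewrite vp_dvd -ltnNge; apply/orP; right.
  by move: r0; rewrite /r_; lia.
have v_ge2 : (2 <= vp p (a ^+ p.-1 - 1))%N by move: r_ge1; rewrite /r_; lia.
set v := vp p _ in vp_dvd v_ge2.
have dE : d_ p s a = (minn v.-1 s)%:Z.
  rewrite /d_ /r_ -/v; have -> : v%:Z - 1 = v.-1%:Z by lia.
  by rewrite /Num.min; case: ltP => ?; lia.
have d_ge0 : 0 <= d_ p s a by rewrite dE.
set D := minn v.-1 s in dE.
have aD : (s <= D)%N || ~~ (p%:Z ^+ D.+2 %| a ^+ p.-1 - 1)%Z.
  by rewrite vp_dvd /D; lia.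
(* The conditional follows the shape of the statement; below phi(p^s) the value of [k_] is 0 as
   well. *)
pose kk m := if (m < totient (p ^ s))%N then 0%N else k_ p s a m.
pose Dl m : {poly rat} := ((w m)%:~R * (C_ p s aj m)%:R) *: ('X^(j_ p s a m) *
  \sum_(0 <= i < (p ^ k_ p s a m).-1) ((a' m)%:~R *: 'X^(p ^ (s - k_ p s a m))) ^+ i).
pose B m : {poly rat} := if (m < totient (p ^ s))%N then B0 m
  else ((p ^ k_ p s a m * C_ p s aj m)%:R)^-1 *: ('X^m + Dl m).
have kP m : [/\ (k_ p s a m <= D)%N, (p ^ s - p ^ (s - k_ p s a m) <= m)%N
    & forall k, (k <= D)%N -> (p ^ s - p ^ (s - k) <= m)%N -> (k <= k_ p s a m)%N].
  have [k1 k2 k3] := k_P p s a m d_ge0; rewrite dE in k1 k3.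
  by split; [exact: k1 | exact: k2 | exact: k3].
have ks m : (k_ p s a m <= s)%N.
  by have [h _ _] := kP m; rewrite (leq_trans h) // geq_minr.
(* A full geometric sum would end in degree m exactly; the sum in [delta] stops one term earlier, so
   it has degree below m. *)
have jE m : (j_ p s a m + p ^ (s - k_ p s a m) * (p ^ k_ p s a m).-1 = m)%N.
  have [_ km _] := kP m; rewrite /j_ -subn1 mulnBr muln1 -expnD subnK //.
  by rewrite subnK.
have Dl_sz m : (size (Dl m) <= m)%N.
  apply: leq_trans (size_scale_leq _ _) _; rewrite big_distrr /=.
  rewrite big_mkord; apply: leq_trans (size_sum _ _ _) _; apply/bigmax_leqP => i _.
  rewrite exprZn -scalerAr -exprM -exprD.
  apply: leq_trans (size_scale_leq _ _) _; rewrite size_polyXn -[leqRHS](jE m).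
  by rewrite ltn_add2l ltn_pmul2l ?expn_gt0 ?prime_gt0.
have pkC_neq0 m : ((p ^ k_ p s a m * C_ p s aj m)%:R)^-1 != 0 :> rat.
  rewrite invr_eq0 pnatr_eq0 -lt0n muln_gt0 expn_gt0 prime_gt0 //=.
  exact: prod_family_gt0.
have B_eval m : (map_poly (in_alg K) (B m)).[theta]
  = (if (m < totient (p ^ s))%N then theta ^+ m / (C_ p s aj m)%:R
     else (theta ^+ m + delta p s a aj a' w K theta m)
            / (p ^ k_ p s a m * C_ p s aj m)%:R).
  rewrite /B; case: ifP => _ //.
  rewrite map_polyZ hornerZ mulrC fmorphV rmorph_nat; congr (_ / _).
  rewrite rmorphD /= hornerD map_polyXn hornerXn; congr (_ + _).
  rewrite map_polyZ hornerZ [map_poly _ (_ * _)]rmorphM /= hornerM map_polyXn.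
  rewrite hornerXn /delta mulrA.
  congr (_ * _ * _).
    by rewrite -[LHS]/(in_alg K _) rmorphM rmorph_int rmorph_nat.
  rewrite rmorph_sum horner_sum; apply: eq_bigr => i _.
  by rewrite rmorphXn /= horner_exp map_polyZ hornerZ map_polyXn hornerXn /= scaler_int.
have -> : (fun m : 'I_(p ^ s) =>
          if (m < totient (p ^ s))%N then theta ^+ m / (C_ p s aj m)%:R
          else (theta ^+ m + delta p s a aj a' w K theta m)
                 / (p ^ k_ p s a m * C_ p s aj m)%:R)
    = (fun m : 'I_(p ^ s) => (map_poly (in_alg K) (B m)).[theta]).
  by apply/funext => m; rewrite B_eval.
apply: (integral_basis_pure p s a aj K theta kk) => //.
- move=> m _; rewrite /B; case: ifP => // _.
  by rewrite size_scale // size_polyDl size_polyXn // ltnS.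
- move=> m _; rewrite /B /kk; case: ifP => _; first by rewrite B0_lead mul1n.
  by rewrite lead_coefZ lead_coefDl ?size_polyXn ?ltnS // lead_coefXn mulr1.
- move=> m mn; rewrite B_eval; case: ltnP => [//|phim].
  have hm : (totient (p ^ s) <= m < p ^ s)%N by rewrite phim.
  have [kD _ _] := kP m; have := wP m hm; have := a'P m hm; rewrite /= /delta.
  set k := k_ p s a m in kD *; move=> [a'1 a'2] wm.
  have pk : (p%:Z ^+ k.+1 %| a ^+ p.-1 - 1)%Z.
    rewrite vp_dvd -(prednK (ltnW v_ge2)) ltnS.
    by rewrite (leq_trans kD) // geq_minl.
  have kd : (k <= s)%N := ks m.
  apply: (algebraic_integer_block p s k _ m _ a) => //.
  (* The exponent of a defining a', times p^k, is (p - 2) p^(s-1) if k < s and (p - 2) p^s if k =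
     s. *)
  + have [ks_lt|s_le] := ltnP k s.
      apply: (dvdz_root_of_unity_approx p k s.-1 ((p - 2) * p ^ (s - k - 1))) => //.
        rewrite -mulnA -expnD -subnDA addn1; congr (_ * p ^ _)%N.
        by apply: succn_inj; rewrite -addnS subnK // prednK.
      by rewrite -PoszX -eqz_mod_dvd; apply/eqP/a'1.
    have ksE : k = s by apply/eqP; rewrite eqn_leq kd.
    apply: (dvdz_root_of_unity_approx p k k (p - 2)) => //.
    by rewrite -PoszX -eqz_mod_dvd; apply/eqP/a'2.
  + by rewrite -PoszX -eqz_mod_dvd -subn1; apply/eqP.
  + exact: prod_family_gt0.
  + apply: (integral_expn _ _ n_gt0); rewrite thetaE; exact: integral_id.
(* Below phi(p^s) = p^s - p^(s-1) the degree excludes exponent 1; above, the maximality of [k_]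
   excludes k + 1. *)
- right; exists D => // m mn; rewrite /kk; case: ltnP => [phim|phim].
    by rewrite subn1 -totient_prime_pow // phim orbT.
  have [kD km kmax] := kP m; have [//|kD'] := leqP D (k_ p s a m).
  by rewrite ltnNge; apply/negP => /(kmax _ kD'); rewrite ltnn.
Qed.
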